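(* Let $\Bbbk$ be a commutative $\mathbb{Z}[1/6,\mathbf{n}]$-algebra. The $\Bbbk$-linear tensor ideal of $\Bbbk\mathcal{B}$ generated by the seven-term fundamental relation and the reduction rules (E1)–(E3) (all listed in the context) contains $p^{(E)}(\mathbf{n})\,[\,]$, where $[\,]$ is the empty diagram and $p^{(E)}(\mathbf{n})$ is the monic polynomial $$p^{(E)}(\mathbf{n}) = (\mathbf{n}-27)(\mathbf{n}-15)(\mathbf{n}-9)(\mathbf{n}-6)(\mathbf{n}-3)^2(\mathbf{n}-1)\,\mathbf{n}^2(\mathbf{n}+1)(\mathbf{n}+3)^2.$$
   Context: $\mathbb{Z}[1/6,\mathbf{n}]$ is the polynomial ring in the formal variable $\mathbf{n}$ over $\mathbb{Z}[1/6]$. An oriented string diagram is a finite directed multigraph with numbered univalent boundary points, in which every other vertex is trivalent and is either a source (all three edges outgoing) or a sink (all three edges incoming), possibly together with finitely many directed vertex-free circles and directed vertex-free arcs joining two boundary points. Diagrams are considered up to isomorphism fixing the boundary points (there is no planarity and no cyclic order at vertices). A boundary point is ''in'' if its edge is directed from the boundary into the diagram, and ''out'' otherwise. $[\,]$ is the empty diagram. $\mathcal{B}$ is the cobordism category of such oriented trivalent graphs: objects form the free monoid on two generators (the two directions, which form a dual pair), morphisms are oriented string diagrams with the prescribed boundary, composition is gluing along boundary points with compatible directions, tensor product is disjoint union. It is a rigid symmetric monoidal category. $\Bbbk\mathcal{B}$ is the free $\Bbbk$-linear category on $\mathcal{B}$. The tensor ideal generated by a set of relations is the smallest family of $\Bbbk$-submodules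 of the morphism modules that contains the differences of the two sides of the relations and is closed under composition and tensor product with arbitrary morphisms; thus its closed part is spanned by all results of gluing a relation into an arbitrary diagram with matching boundary so as to close it up. Seven-term fundamental relation. There are five boundary points: $b_0$ (in) and $b_1,b_2,b_3,b_4$ (out). For a partition of $\{1,2,3,4\}$ into two pairs $\{i,j\},\{k,l\}$, let $W_{ij|kl}$ be the tree with a sink $v_0$ and two sources $v_1,v_2$ and edges $b_0\to v_0$, $v_1\to v_0$, $v_2\to v_0$, $v_1\to b_i$, $v_1\to b_j$, $v_2\to b_k$, $v_2\to b_l$. For $i\in\{1,2,3,4\}$ let $V_i$ be the diagram consisting of an arc $b_0\to b_i$ and one source with edges to the three remaining out-points. The relation is $$W_{12|34}+W_{13|24}+W_{14|23} = 6V_1+6V_2+6V_3+6V_4.$$ Reduction rules: (E1) a directed vertex-free circle equals $\mathbf{n}\,[\,]$; (E2) the bigon (a source and a sink joined by two edges directed from the source to the sink, the source having its remaining edge to an out-point and the sink its remaining edge from an in-point) equals $2(\mathbf{n}+3)$ times the arc from the in-point to the out-point; (E3) with in-points $a_1,a_2$ and out-points $c_1,c_2$: let $S$ be the square, i.e. sinks $s_1,s_2$ and sources $t_1,t_2$ with edges $t_i\to s_j$ for all $i,j\in\{1,2\}$, and legs $a_j\to s_j$, $t_i\to c_i$; let $A$ be the tree with one source $t$ and one sink $s$, edges $t\to s$, $a_1\to s$, $a_2\to s$, $t\to c_1$, $t\to c_2$; let $I$ be the pair of arcs $a_1\to c_1$, $a_2\to c_2$ and $U$ the pair of arcs $a_1\to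 c_2$, $a_2\to c_1$. Then $S=(3-\mathbf{n})A+6(\mathbf{n}+3)I+6(\mathbf{n}+3)U$. *)

(* Defs.v *)
From HB Require Import structures.
From mathcomp Require Import all_boot all_order all_fingroup all_algebra.
From mathcomp Require Import generic_quotient finmap monalg.

Set Implicit Arguments.
Unset Strict Implicit.
Unset Printing Implicit Defensive.

Import GRing.Theory Num.Theory.
Local Open Scope quotient_scope.
Local Open Scope ring_scope.


Definition Zinv6_pred : {pred rat} :=
  [pred x : rat | \pi(6).-nat `|denq x|%N].

Lemma Zinv6_predP (x : rat) :
  reflect (exists e : nat, 6 ^+ e * x \is a Num.int) (x \in Zinv6_pred).
Proof.
have d0 : (0 < `|denq x|)%N by rewrite absz_gt0 denq_neq0.
apply: (iffP idP) => [|[e] /intrP[m xm]]; rewrite inE.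
  move=> px; exists `|denq x|%N.
  have /dvdnP[q qE] : (`|denq x| %| 6 ^ `|denq x|)%N.
    apply/dvdn_partP => // p pd.
    rewrite p_part.
    have := pnatPpi px pd; rewrite mem_primes => /and3P[pp _ p6].
    apply: dvdn_trans (dvdn_exp2r _ p6).
    by apply: dvdn_exp2l; apply: ltnW; apply: ltn_logl.
  have -> : (6 : rat) ^+ `|denq x| = q%:R * (denq x)%:~R.
    rewrite -[6]/(6%:R) -natrX qE natrM; congr (_ * _).
    by rewrite -[in RHS](absz_denq x).
  by rewrite -mulrA [_%:~R * x]mulrC -numqE rpredM ?rpred_nat ?intr_int.
suff dv : (`|denq x| %| 6 ^ e)%N.
  by apply: pnat_dvd dv _; rewrite pnatX pnat_pi.
have E : (6 ^ e)%N%:Z * numq x = m * denq x.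
  apply/eqP; rewrite -(eqr_int rat) !rmorphM /= -xm numqE mulrA.
  by rewrite -pmulrn natrX.
have := congr1 absz E; rewrite !abszM absz_nat => E'.
rewrite -(@Gauss_dvdl _ _ `|numq x|%N); last by rewrite coprime_sym coprime_num_den.
by rewrite E' dvdn_mull.
Qed.

Lemma Zinv6_pred_subring : subring_closed Zinv6_pred.
Proof.
split; first by apply/Zinv6_predP; exists 0%N.
- move=> x y /Zinv6_predP[a xa] /Zinv6_predP[b yb]; apply/Zinv6_predP.
  exists (a + b)%N; rewrite mulrBr {1}addnC !exprD -!mulrA.
  by rewrite rpredB // rpredM // rpredX // rpred_nat.
- move=> x y /Zinv6_predP[a xa] /Zinv6_predP[b yb]; apply/Zinv6_predP.
  by exists (a + b)%N; rewrite exprD mulrACA rpredM.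
Qed.

HB.instance Definition _ :=
  GRing.isSubringClosed.Build rat Zinv6_pred Zinv6_pred_subring.

Record Zinv6 := MkZinv6 { Zinv6_val : rat; _ : Zinv6_val \in Zinv6_pred }.

HB.instance Definition _ := [isSub for Zinv6_val].
HB.instance Definition _ := [Choice of Zinv6 by <:].
HB.instance Definition _ := [SubChoice_isSubComNzRing of Zinv6 by <:].


(* The letter [true] is the direction of a strand running from the domain of a
   morphism to its codomain, the letter [false] is the opposite direction. *)
Definition object := seq bool.

(* The boundary points of a morphism [X -> Y] are [Dom i] for [i < size X] and
   [Cod j] for [j < size Y]; the vertices of a graph are [Vtx v]. *)
Inductive point := Dom of nat | Cod of nat | Vtx of nat.

Definition point_code (p : point) : nat + nat + nat :=
  match p with
  | Dom i => inl (inl i)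
  | Cod j => inl (inr j)
  | Vtx v => inr v
  end.

Definition point_decode (c : nat + nat + nat) : point :=
  match c with
  | inl (inl i) => Dom i
  | inl (inr j) => Cod j
  | inr v => Vtx v
  end.

Lemma point_codeK : cancel point_code point_decode.
Proof. by case. Qed.

HB.instance Definition _ := Countable.copy point (can_type point_codeK).

(* An edge is the pair of its tail and its head. *)
Definition edge := (point * point)%type.

(* A directed multigraph with vertices [Vtx 0], ..., [Vtx (nvert - 1)],
   together with [ncirc] directed vertex-free circles. The list of edges is
   only relevant up to permutation, see [iso] below; an edge joining two
   boundary points is a vertex-free arc. *)
Record graph := Graph { nvert : nat; edges : seq edge; ncirc : nat }.

Definition graph_code (d : graph) := (nvert d, edges d, ncirc d).
Definition graph_decode c := let: (n, E, c) := c in Graph n E c.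

Lemma graph_codeK : cancel graph_code graph_decode.
Proof. by case. Qed.

HB.instance Definition _ := Countable.copy graph (can_type graph_codeK).

(* The out-degree, then the in-degree. *)
Definition degs (E : seq edge) (p : point) : nat * nat :=
  (count (fun e => e.1 == p) E, count (fun e => e.2 == p) E).

Definition is_point (X Y : object) (n : nat) (p : point) : bool :=
  match p with
  | Dom i => i < size X
  | Cod j => j < size Y
  | Vtx v => v < n
  end%N.

Definition in_degs : nat * nat := (1, 0)%N.
Definition out_degs : nat * nat := (0, 1)%N.
Definition source_degs : nat * nat := (3, 0)%N.
Definition sink_degs : nat * nat := (0, 3)%N.

(* A boundary point carries exactly one edge: an "in" point is the tail of its
   edge, an "out" point is the head of its edge. *)
Definition degs_ok (X Y : object) (E : seq edge) (p : point) : bool :=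
  match p with
  | Dom i => degs E p == if nth true X i then in_degs else out_degs
  | Cod j => degs E p == if nth true Y j then out_degs else in_degs
  | Vtx v => (degs E p == source_degs) || (degs E p == sink_degs)
  end.

Definition wf (X Y : object) (d : graph) : bool :=
  [&& all (fun e => is_point X Y (nvert d) e.1 &&
                    is_point X Y (nvert d) e.2) (edges d),
      all (fun i => degs_ok X Y (edges d) (Dom i)) (iota 0 (size X)),
      all (fun j => degs_ok X Y (edges d) (Cod j)) (iota 0 (size Y))
    & all (fun v => degs_ok X Y (edges d) (Vtx v)) (iota 0 (nvert d))].

Record diag (X Y : object) := Diag { diag_val :> graph; _ : wf X Y diag_val }.

HB.instance Definition _ X Y := [isSub for @diag_val X Y].
HB.instance Definition _ X Y := [Choice of diag X Y by <:].

Lemma diag_wf X Y (d : diag X Y) : wf X Y d.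
Proof. exact: valP d. Qed.

Definition map_points (h : point -> point) (E : seq edge) : seq edge :=
  [seq (h e.1, h e.2) | e <- E].


Definition perm_vtx n (s : 'S_n) (p : point) : point :=
  if p is Vtx v then
    if insub v is Some i then Vtx (s i) else p
  else p.

Definition iso (d d' : graph) : bool :=
  [&& nvert d == nvert d', ncirc d == ncirc d'
    & [exists s : 'S_(nvert d),
         perm_eq (map_points (perm_vtx s) (edges d)) (edges d')]].

Lemma map_points_comp h k E :
  map_points h (map_points k E) = map_points (h \o k) E.
Proof. by rewrite /map_points -map_comp. Qed.

Lemma eq_map_points h k E : h =1 k -> map_points h E = map_points k E.
Proof. by move=> hk; apply: eq_map => e; rewrite !hk. Qed.

Lemma map_points_id E : map_points id E = E.
Proof. by rewrite /map_points -[RHS]map_id; apply: eq_map => -[]. Qed.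

Lemma perm_map_points h E E' :
  perm_eq E E' -> perm_eq (map_points h E) (map_points h E').
Proof. exact: perm_map. Qed.

Lemma perm_vtx1 n : perm_vtx (1 : 'S_n)%g =1 id.
Proof. by case=> //= v; case: insubP => // i _ <-; rewrite perm1. Qed.

Lemma perm_vtxM n (s t : 'S_n) : perm_vtx (s * t)%g =1 perm_vtx t \o perm_vtx s.
Proof.
case=> //= v; case: insubP => [i _ _|nv] /=; last by rewrite insubN.
by rewrite valK permM.
Qed.

Lemma iso_refl : reflexive iso.
Proof.
move=> d; rewrite /iso !eqxx /=; apply/existsP; exists 1%g.
by rewrite (eq_map_points _ (@perm_vtx1 _)) map_points_id.
Qed.

Lemma iso_sym : symmetric iso.
Proof.
suff S d d' : iso d d' -> iso d' d by move=> d d'; apply/idP/idP; apply: S.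
case: d d' => [n E c] [n' E' c'] /and3P[/= /eqP nn /eqP cc].
move: nn cc => <- <- /existsP[s sE]; rewrite /iso /= !eqxx /=.
apply/existsP; exists (s^-1)%g; rewrite perm_sym.
have := perm_map_points (perm_vtx s^-1%g) sE.
rewrite map_points_comp -(eq_map_points _ (perm_vtxM _ _)) mulgV.
by rewrite (eq_map_points _ (@perm_vtx1 _)) map_points_id.
Qed.

Lemma iso_trans : transitive iso.
Proof.
case=> [n' E' c'] [n E c] [n'' E'' c''] /and3P[/= /eqP nn /eqP cc].
move: nn cc => <- <- /existsP[s sE] /and3P[/= /eqP nn /eqP cc].
move: nn cc => <- <- /existsP[t tE]; rewrite /iso /= !eqxx /=.
apply/existsP; exists (s * t)%g.
rewrite (eq_map_points _ (perm_vtxM _ _)) -map_points_comp.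
exact: perm_trans (perm_map_points _ sE) tE.
Qed.

Definition diag_iso (X Y : object) : rel (diag X Y) := fun d d' => iso d d'.

Lemma diag_iso_equiv X Y : equiv_class_of (@diag_iso X Y).
Proof.
split=> [d|d d'|d d' d'']; [exact: iso_refl|exact: iso_sym|exact: iso_trans].
Qed.

Canonical diag_iso_rel X Y := EquivRelPack (diag_iso_equiv X Y).

(* The morphisms [X -> Y] of the cobordism category. *)
Definition hom (X Y : object) := {eq_quot (@diag_iso X Y)}.

HB.instance Definition _ X Y := Choice.on (hom X Y).
HB.instance Definition _ X Y := EqQuotient.on (hom X Y).


Definition dom_shift (p : point) (a b n : nat) : point :=
  match p with
  | Dom i => Dom (a + i)
  | Cod j => Cod (b + j)
  | Vtx v => Vtx (n + v)
  end%N.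

Definition tens_graph (a b : nat) (d d' : graph) : graph :=
  Graph (nvert d + nvert d')
        (edges d ++
         map_points (fun p => dom_shift p a b (nvert d)) (edges d'))
        (ncirc d + ncirc d').

(* Erasing a vertex [p] of out-degree and in-degree one: its two edges are
   merged into one or, when they coincide, turned into a circle. *)
Definition smooth (p : point) (Ec : seq edge * nat) : seq edge * nat :=
  let: (E, c) := Ec in
  let rest := [seq e <- E | (e.1 != p) && (e.2 != p)] in
  if (p, p) \in E then (rest, c.+1)
  else ([seq (e.1, e'.2) | e <- [seq e <- E | e.2 == p],
                           e' <- [seq e <- E | e.1 == p]] ++ rest, c).

Definition cod_to_vtx (n : nat) (p : point) : point :=
  if p is Cod j then Vtx (n + j) else p.

Definition dom_to_vtx (m n : nat) (p : point) : point :=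
  match p with
  | Dom j => Vtx (n + j)
  | Cod k => Cod k
  | Vtx v => Vtx (m + v)
  end.

(* The composite [g \o f] along [m] glued boundary points: these become
   bivalent vertices, numbered from [nvert f + nvert g] on, of the union of the
   two graphs, and they are then erased. *)
Definition comp_graph (m : nat) (g f : graph) : graph :=
  let n := (nvert f + nvert g)%N in
  let E := map_points (cod_to_vtx n) (edges f) ++
           map_points (dom_to_vtx (nvert f) n) (edges g) in
  let: (E', c) := foldr smooth (E, (ncirc f + ncirc g)%N)
                    [seq Vtx (n + j)%N | j <- iota 0 m] in
  Graph n E' c.

Arguments degs : simpl never.
Arguments smooth : simpl never.

Lemma degs_cat E F p :
  degs (E ++ F) p = ((degs E p).1 + (degs F p).1, (degs E p).2 + (degs F p).2)%N.
Proof. by rewrite /degs !count_cat. Qed.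

Lemma perm_degs E F p : perm_eq E F -> degs E p = degs F p.
Proof. by move=> /seq.permP EF; rewrite /degs !EF. Qed.

Lemma degs_map h E p q :
    (forall e, e \in E -> ((h e.1 == q) = (e.1 == p)) /\
                          ((h e.2 == q) = (e.2 == p))) ->
  degs (map_points h E) q = degs E p.
Proof.
move=> hE; rewrite /degs !count_map; 
by congr (_, _); apply: eq_in_count => e /hE[h1 h2] /=; rewrite ?h1 ?h2.
Qed.

Lemma degs_map0 h E q :
    (forall e, e \in E -> ((h e.1 == q) = false) /\ ((h e.2 == q) = false)) ->
  degs (map_points h E) q = (0, 0)%N.
Proof.
move=> hE; rewrite /degs !count_map.
by congr (_, _); apply/eqP; rewrite -leqn0 leqNgt -has_count;
  apply/hasPn => e /hE /= [h1 h2]; rewrite /= ?h1 ?h2.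
Qed.

Definition degs_spec X Y n E p :=
  if is_point X Y n p then degs_ok X Y E p else degs E p == (0, 0)%N.

Lemma degs_pos E (e : edge) :
  e \in E -> ((degs E e.1).1 != 0)%N /\ ((degs E e.2).2 != 0)%N.
Proof.
by move=> eE; split; rewrite -lt0n -has_count; apply/hasP; exists e => /=.
Qed.

Lemma wfP X Y d :
  reflect (forall p, degs_spec X Y (nvert d) (edges d) p) (wf X Y d).
Proof.
apply: (iffP and4P) => [[/allP Ed /allP dX /allP dY /allP dV] p|H].
  rewrite /degs_spec; case: ifPn => [|np].
    by case: p => i /= iP; [apply: dX|apply: dY|apply: dV]; rewrite mem_iota.
  apply/eqP; congr (_, _); apply/eqP; rewrite -leqn0 leqNgt -has_count;
  apply/hasPn => e /Ed /andP[p1 p2]; apply: contra np => /eqP <- //.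
split; apply/allP.
- move=> e eE; have [e1 e2] := degs_pos eE.
  have := H e.1; rewrite /degs_spec; case: ifP => // _; last first.
    by move/eqP => d0; rewrite d0 in e1.
  have := H e.2; rewrite /degs_spec; case: ifP => // _.
  by move/eqP => d0; rewrite d0 in e2.
- by move=> i; rewrite mem_iota => /= iX; have := H (Dom i); rewrite /degs_spec /= iX.
- by move=> i; rewrite mem_iota => /= iX; have := H (Cod i); rewrite /degs_spec /= iX.
- by move=> i; rewrite mem_iota => /= iX; have := H (Vtx i); rewrite /degs_spec /= iX.
Qed.

Lemma wf_point X Y d e : wf X Y d -> e \in edges d ->
  is_point X Y (nvert d) e.1 /\ is_point X Y (nvert d) e.2.
Proof. by case/and4P => /allP Ed _ _ _ /Ed /andP. Qed.

Lemma wf_degs X Y d p : wf X Y d -> is_point X Y (nvert d) p ->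
  degs_ok X Y (edges d) p.
Proof. by move=> /wfP/(_ p); rewrite /degs_spec => + pP; rewrite pP. Qed.

Lemma wf_degs0 X Y d p : wf X Y d -> ~~ is_point X Y (nvert d) p ->
  degs (edges d) p = (0, 0)%N.
Proof. by move=> /wfP/(_ p); rewrite /degs_spec => /[swap] /negbTE -> /eqP. Qed.


Lemma tens_degsl X Y X' Y' d d' p :
  wf X Y d -> wf X' Y' d' -> is_point X Y (nvert d) p ->
  degs (edges (tens_graph (size X) (size Y) d d')) p = degs (edges d) p.
Proof.
move=> wd wd' pP; rewrite degs_cat [in X in (X, _)](@degs_map0 _ _ p).
  rewrite [in X in (_, X)](@degs_map0 _ _ p) /= ?addn0 -?surjective_pairing //.
  by move=> e _; split; apply: contraTF pP => /eqP <-; case: (_ e) => //= i;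
    rewrite -leqNgt leq_addr.
by move=> e _; split; apply: contraTF pP => /eqP <-; case: (_ e) => //= i;
    rewrite -leqNgt leq_addr.
Qed.

Lemma tens_degsr X Y X' Y' d d' p :
  wf X Y d -> wf X' Y' d' ->
  degs (edges (tens_graph (size X) (size Y) d d'))
    (dom_shift p (size X) (size Y) (nvert d)) = degs (edges d') p.
Proof.
move=> wd wd'; rewrite degs_cat (@wf_degs0 X Y) //; last first.
  by case: p => i /=; rewrite -leqNgt leq_addr.
rewrite (@degs_map _ _ p) /= ?add0n -?surjective_pairing // => e _.
by split; move: (_ e) p => [i|i|i] [j|j|j] //;
  apply/eqP/eqP => [[/addnI ->]|[->]].
Qed.

Lemma tens_wf X Y X' Y' d d' : wf X Y d -> wf X' Y' d' ->
  wf (X ++ X') (Y ++ Y') (tens_graph (size X) (size Y) d d').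
Proof.
move=> wd wd'; apply/wfP => p; rewrite /degs_spec.
have [pP|npP] := boolP (is_point X Y (nvert d) p).
  have -> : is_point (X ++ X') (Y ++ Y') (nvert d + nvert d') p.
    by case: p pP => i /= iP; rewrite ?size_cat ltn_addr.
  have := wf_degs wd pP; have := tens_degsl wd wd' pP.
  by case: p pP => i /= iP ->; rewrite ?nth_cat ?iP.
have [q pE] : exists q, p = dom_shift q (size X) (size Y) (nvert d).
  case: p npP => i /=; rewrite -leqNgt => iP.
  - by exists (Dom (i - size X)); rewrite /= subnKC.
  - by exists (Cod (i - size Y)); rewrite /= subnKC.
  - by exists (Vtx (i - nvert d)); rewrite /= subnKC.
have -> : is_point (X ++ X') (Y ++ Y') (nvert d + nvert d') p =
          is_point X' Y' (nvert d') q.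
  by rewrite pE; case: (q) => i /=; rewrite ?size_cat ltn_add2l.
have := tens_degsr q wd wd'; rewrite -pE => dE.
case: ifPn => qP; last by rewrite dE (wf_degs0 wd').
have := wf_degs wd' qP; rewrite pE in dE *.
case: q qP dE {pE} => i /= iP ->;
  by rewrite ?nth_cat ?ltnNge ?leq_addr /= ?addKn.
Qed.

Lemma perm_smooth p E F c : perm_eq E F ->
  perm_eq (smooth p (E, c)).1 (smooth p (F, c)).1 /\
  (smooth p (E, c)).2 = (smooth p (F, c)).2.
Proof.
move=> EF; rewrite /smooth (perm_mem EF); case: ifP => _ /=.
  by split=> //; apply: perm_filter.
split=> //; apply: perm_cat; last exact: perm_filter.
by apply: perm_allpairs; apply: perm_filter.
Qed.

Definition avoids p : pred edge := fun e => (e.1 != p) && (e.2 != p).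

Lemma count_tail_avoids p F : all (avoids p) F -> count (fun e => e.1 == p) F = 0%N.
Proof.
move=> /allP aF; apply/eqP; rewrite -leqn0 leqNgt -has_count.
by apply/hasPn => e /aF /andP[].
Qed.

Lemma count_head_avoids p F : all (avoids p) F -> count (fun e => e.2 == p) F = 0%N.
Proof.
move=> /allP aF; apply/eqP; rewrite -leqn0 leqNgt -has_count.
by apply/hasPn => e /aF /andP[].
Qed.

Lemma avoids_degs p F : degs F p = (0, 0)%N -> all (avoids p) F.
Proof.
case=> c1 c2; apply/allP => e eF; rewrite /avoids -negb_or.
have [] := degs_pos eF; rewrite /= => e1 e2; apply/negP => /orP[] /eqP pE.
  by rewrite pE c1 in e1.
by rewrite pE c2 in e2.
Qed.

Lemma smooth_split p E : degs E p = (1, 1)%N ->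
  (exists2 F, all (avoids p) F & perm_eq E ((p, p) :: F)) \/
  (exists a b, exists2 F, [&& a != p, b != p & all (avoids p) F]
     & perm_eq E [:: (a, p), (p, b) & F]).
Proof.
move=> dE.
have /hasP[[p' b] e1E /= /eqP e1p] : has (fun e => e.1 == p) E.
  by rewrite has_count; case: dE => ->.
have E1 := perm_to_rem e1E; rewrite {p'}e1p in e1E E1 *.
have := dE; rewrite (perm_degs _ E1) /degs /= eqxx; have [bp|bp] := eqVneq b p.
  rewrite bp in E1 *; case=> d1 d2; left; exists (rem (p, p) E) => //; apply: avoids_degs; rewrite /degs; congr (_, _); [exact: d1|exact: d2].
set F := rem _ _ in E1 *; case=> d1 d2; right.
have /hasP[[a p'] e2E /= /eqP e2p] : has (fun e => e.2 == p) F.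
  by rewrite has_count [X in (0 < X)%N]d2.
have E2 := perm_to_rem e2E; rewrite {p'}e2p in e2E E2 *.
move: d1 d2; rewrite !(seq.permP E2) /= eqxx.
have [->//|ap] := eqVneq a p; case=> d1 [d2].
exists a, b, (rem (a, p) F).
  by rewrite ap bp; apply: avoids_degs; rewrite /degs; congr (_, _); [exact: d1|exact: d2].
by apply/seq.permP => x; rewrite (seq.permP E1) /= (seq.permP E2) /= addnCA.
Qed.

Lemma smooth_loop p F c : all (avoids p) F ->
  smooth p ((p, p) :: F, c) = (F, c.+1).
Proof. by move=> aF; rewrite /smooth mem_head /= eqxx /= (all_filterP aF). Qed.

Lemma smooth_path p a b F c : a != p -> b != p -> all (avoids p) F ->
  smooth p ([:: (a, p), (p, b) & F], c) = ((a, b) :: F, c).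
Proof.
move=> ap bp aF; rewrite /smooth !inE !xpair_eqE eqxx /=.
rewrite !(eq_sym p) (negbTE ap) (negbTE bp) /= !eqxx /=.
have -> : (p, p) \in F = false.
  by apply: contraTF aF => pF; apply/allPn; exists (p, p) => //; rewrite /avoids /= eqxx.
have f1 : [seq e <- F | e.1 == p] = [::].
  by apply: size0nil; rewrite size_filter count_tail_avoids.
have f2 : [seq e <- F | e.2 == p] = [::].
  by apply: size0nil; rewrite size_filter count_head_avoids.
by rewrite f1 f2 /= (all_filterP aF).
Qed.

Lemma smooth_degs p E c q : degs E p = (1, 1)%N ->
  degs (smooth p (E, c)).1 q = if q == p then (0, 0)%N else degs E q.
Proof.
case/smooth_split => [[F aF EF]|[a [b [F /and3P[ap bp aF] EF]]]].
  rewrite (perm_degs _ (perm_smooth p c EF).1) (perm_degs _ EF).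
  rewrite smooth_loop //=; case: eqVneq => [->|qp].
    by rewrite /degs count_tail_avoids ?count_head_avoids.
  by rewrite /degs /= ![p == q]eq_sym (negbTE qp).
rewrite (perm_degs _ (perm_smooth p c EF).1) (perm_degs _ EF).
rewrite smooth_path //=; case: eqVneq => [->|qp].
  by rewrite /degs /= (negbTE ap) (negbTE bp) count_tail_avoids ?count_head_avoids.
by rewrite /degs /= ![p == q]eq_sym (negbTE qp).
Qed.

Lemma foldr_smooth_perm ps E F c : perm_eq E F ->
  perm_eq (foldr smooth (E, c) ps).1 (foldr smooth (F, c) ps).1 /\
  (foldr smooth (E, c) ps).2 = (foldr smooth (F, c) ps).2.
Proof.
move=> EF; elim: ps => //= p ps [].
case: (foldr smooth (E, c) ps) => E' cE; case: (foldr _ _ _) => F' cF /= EF' ->.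
exact: perm_smooth.
Qed.

Lemma foldr_smooth_degs ps E c q : uniq ps ->
    {in ps, forall p, degs E p = (1, 1)%N} ->
  degs (foldr smooth (E, c) ps).1 q = if q \in ps then (0, 0)%N else degs E q.
Proof.
elim: ps q => //= p ps IH q /andP[pps ups] H.
have {}IH r := IH r ups (fun x xps => H x (mem_behead (s := p :: ps) xps)).
move: IH; case: (foldr _ _ _) => E' c' /= IH.
rewrite smooth_degs; last by rewrite IH (negbTE pps) H ?mem_head.
by rewrite inE; case: eqVneq => //= _; rewrite IH.
Qed.

Lemma smooth_map h p E c : injective h ->
  smooth (h p) (map_points h E, c) =
  (map_points h (smooth p (E, c)).1, (smooth p (E, c)).2).
Proof.
move=> hI; rewrite /smooth.
have -> : (h p, h p) \in map_points h E = ((p, p) \in E).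
  by rewrite /map_points (mem_map (f := fun e => (h e.1, h e.2)) _ E (p, p)) // => -[? ?] [? ?] /= [/hI -> /hI ->].
have R : [seq e <- map_points h E | (e.1 != h p) && (e.2 != h p)] =
         map_points h [seq e <- E | (e.1 != p) && (e.2 != p)].
  by rewrite /map_points filter_map; congr map; apply: eq_filter => e /=;
     rewrite !(inj_eq hI).
rewrite R; case: ifP => _ //=; congr (_, _); rewrite /map_points map_cat.
have -> : [seq e <- [seq (h e.1, h e.2) | e <- E] | e.2 == h p] =
          [seq (h e.1, h e.2) | e <- [seq e <- E | e.2 == p]].
  by rewrite filter_map; congr map; apply: eq_filter => e /=; rewrite (inj_eq hI).
have -> : [seq e <- [seq (h e.1, h e.2) | e <- E] | e.1 == h p] =
          [seq (h e.1, h e.2) | e <- [seq e <- E | e.1 == p]].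
  by rewrite filter_map; congr map; apply: eq_filter => e /=; rewrite (inj_eq hI).
by congr (_ ++ _); rewrite map_allpairs allpairs_mapl allpairs_mapr.
Qed.

Lemma foldr_smooth_map h ps E c : injective h ->
  foldr smooth (map_points h E, c) (map h ps) =
  (map_points h (foldr smooth (E, c) ps).1, (foldr smooth (E, c) ps).2).
Proof.
move=> hI; elim: ps => //= p ps ->.
by rewrite smooth_map // -surjective_pairing.
Qed.

Section CompWf.
Variables (X Y Z : object) (f g : graph) (wf_f : wf X Y f) (wf_g : wf Y Z g).

Let n := (nvert f + nvert g)%N.
Let E := map_points (cod_to_vtx n) (edges f) ++
         map_points (dom_to_vtx (nvert f) n) (edges g).
Let mid := [seq Vtx (n + j)%N | j <- iota 0 (size Y)].

Let degsl q p :
    (forall x, is_point X Y (nvert f) x -> (cod_to_vtx n x == q) = (x == p)) ->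
    (forall x, is_point Y Z (nvert g) x -> (dom_to_vtx (nvert f) n x == q) = false) ->
  degs E q = degs (edges f) p.
Proof.
move=> H1 H2; rewrite degs_cat (@degs_map _ _ p).
  rewrite degs_map0 /= ?addn0 -?surjective_pairing // => e eE.
  by have [] := wf_point wf_g eE; split; apply: H2.
by move=> e eE; have [] := wf_point wf_f eE; split; apply: H1.
Qed.

Let degsr q p :
    (forall x, is_point X Y (nvert f) x -> (cod_to_vtx n x == q) = false) ->
    (forall x, is_point Y Z (nvert g) x -> (dom_to_vtx (nvert f) n x == q) = (x == p)) ->
  degs E q = degs (edges g) p.
Proof.
move=> H1 H2; rewrite degs_cat degs_map0.
  rewrite (@degs_map _ _ p) /= ?add0n -?surjective_pairing // => e eE.
  by have [] := wf_point wf_g eE; split; apply: H2.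
by move=> e eE; have [] := wf_point wf_f eE; split; apply: H1.
Qed.

Let degs_mid j : degs E (Vtx (n + j)) =
  ((degs (edges f) (Cod j)).1 + (degs (edges g) (Dom j)).1,
   (degs (edges f) (Cod j)).2 + (degs (edges g) (Dom j)).2)%N.
Proof.
rewrite degs_cat (@degs_map _ (edges f) (Cod j)) ?(@degs_map _ (edges g) (Dom j)) //.
  move=> e eE; have [e1 e2] := wf_point wf_g eE; move: (e.1) (e.2) e1 e2.
  have H x : is_point Y Z (nvert g) x ->
      (dom_to_vtx (nvert f) n x == Vtx (n + j)) = (x == Dom j).
    case: x => i //= iP; first by apply/eqP/eqP => [[/addnI->]|[->]].
    by apply/eqP => -[/eqP]; rewrite /n -addnA eqn_add2l ltn_eqF // ltn_addr.
  by move=> x y xP yP; split; apply: H.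
move=> e eE; have [e1 e2] := wf_point wf_f eE; move: (e.1) (e.2) e1 e2.
have H x : is_point X Y (nvert f) x ->
    (cod_to_vtx n x == Vtx (n + j)) = (x == Cod j).
  case: x => i //= iP; first by apply/eqP/eqP => [[/addnI->]|[->]].
  by apply/eqP => -[/eqP]; rewrite /n -addnA ltn_eqF // ltn_addr.
by move=> x y xP yP; split; apply: H.
Qed.

Let uniq_mid : uniq mid.
Proof. by rewrite map_inj_uniq ?iota_uniq // => i j [/addnI]. Qed.

Let mid_degs : {in mid, forall p, degs E p = (1, 1)%N}.
Proof.
move=> _ /mapP[j + ->]; rewrite mem_iota /= => jY.
have /= dg := @wf_degs _ _ _ (Dom j) wf_g jY.
have /= df := @wf_degs _ _ _ (Cod j) wf_f jY.
by rewrite degs_mid; move: dg df; case: ifP => _ /eqP -> /eqP ->.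
Qed.

Let in_mid q : (q \in mid) = if q is Vtx v then (n <= v < n + size Y)%N else false.
Proof.
apply/mapP/idP => [[j + ->]|].
  by rewrite mem_iota /= leq_addr ltn_add2l.
case: q => // v /andP[nv vY]; exists (v - n)%N; last by rewrite subnKC.
by rewrite mem_iota /= ltn_subLR.
Qed.

Lemma comp_wf : wf X Z (comp_graph (size Y) g f).
Proof.
rewrite /comp_graph -/n -/E -/mid.
have D q := foldr_smooth_degs (ncirc f + ncirc g)%N q uniq_mid mid_degs.
move: D; case: (foldr _ _ _) => E' c /= D; apply/wfP => p.
rewrite /degs_spec /=; case: p => v /=.
- have DE : degs E' (Dom v) = degs (edges f) (Dom v).
    by rewrite D in_mid; apply: degsl; case.
  rewrite DE; have [vX|vX] := ifP.
    by have := @wf_degs _ _ _ (Dom v) wf_f vX.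
  by rewrite (wf_degs0 wf_f) //= vX.
- have DE : degs E' (Cod v) = degs (edges g) (Cod v).
    by rewrite D in_mid; apply: degsr; case.
  rewrite DE; have [vX|vX] := ifP.
    by have := @wf_degs _ _ _ (Cod v) wf_g vX.
  by rewrite (wf_degs0 wf_g) //= vX.
rewrite D in_mid; have [vn|nv] := ltnP v n; rewrite /=; last first.
  case: ifP => // vY; rewrite -(subnKC nv) degs_mid.
  have vY' : (size Y <= v - n)%N by rewrite leq_subRL // leqNgt vY.
  by rewrite (wf_degs0 wf_f) ?(wf_degs0 wf_g) //= -leqNgt.
have [vf|fv] := ltnP v (nvert f).
  rewrite (degsl (p := Vtx v)).
  - by have := @wf_degs _ _ _ (Vtx v) wf_f vf.
  - case=> //= i iY; apply/eqP => -[iv]; rewrite -iv in vn.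
    by move: vn; rewrite ltnNge leq_addr.
  - case=> //= i iY; apply/eqP => -[iv]; first by move: vn; rewrite -iv ltnNge leq_addr.
    by move: vf; rewrite -iv ltnNge leq_addr.
rewrite (degsr (p := Vtx (v - nvert f))).
- by have := @wf_degs _ _ _ (Vtx (v - nvert f)) wf_g; apply; rewrite /= ltn_subLR.
- case=> //= i iY; apply/eqP => -[iv]; first by move: vn; rewrite -iv ltnNge leq_addr.
  by move: iY; rewrite iv ltnNge fv.
- case=> //= i iY; last by apply/eqP/eqP => -[]; [move=> <-; rewrite addKn|move=> ->; rewrite subnKC].
  by apply/eqP => -[iv]; move: vn; rewrite -iv ltnNge leq_addr.
Qed.
End CompWf.

Definition map_vtx (h : nat -> nat) (p : point) : point :=
  if p is Vtx v then Vtx (h v) else p.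

Lemma map_vtx_inj h : injective h -> injective (map_vtx h).
Proof. by move=> hI [i|i|i] [j|j|j] //= [/hI->]. Qed.

Definition perm_fun n (s : 'S_n) (v : nat) : nat :=
  if insub v is Some i then s i : nat else v.

Lemma perm_vtxE n (s : 'S_n) : perm_vtx s =1 map_vtx (perm_fun s).
Proof. by case=> //= v; rewrite /perm_fun; case: insubP. Qed.

Lemma perm_fun_lt n (s : 'S_n) v : (perm_fun s v < n)%N = (v < n)%N.
Proof. by rewrite /perm_fun; case: insubP => [i -> _|/negbTE //]; rewrite ltn_ord. Qed.

Lemma perm_fun_inj n (s : 'S_n) : injective (perm_fun s).
Proof.
move=> u v; rewrite /perm_fun.
case: insubP => [i _ <-|nu]; case: insubP => [j _ <-|nv] //.
- by move/val_inj/perm_inj->.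
- by move=> E; rewrite -E ltn_ord in nv.
- by move=> E; rewrite E ltn_ord in nu.
Qed.

Lemma iso_map d d' (h : nat -> nat) : injective h ->
    (forall v, v < nvert d -> h v < nvert d)%N ->
    nvert d = nvert d' -> ncirc d = ncirc d' ->
    (exists X Y, wf X Y d) ->
    perm_eq (map_points (map_vtx h) (edges d)) (edges d') -> iso d d'.
Proof.
case: d d' => [n E c] [n' E' c'] /= hI hn nn cc [X [Y wd]].
move: nn cc => <- <- EE; rewrite /iso /= !eqxx /=; apply/existsP.
pose s0 (i : 'I_n) := Ordinal (hn i (ltn_ord i)).
have s0I : injective s0 by move=> i j [/hI/val_inj].
exists (perm s0I); suff -> : map_points (perm_vtx (perm s0I)) E =
  map_points (map_vtx h) E by [].
have H x : is_point X Y n x -> perm_vtx (perm s0I) x = map_vtx h x.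
  by case: x => //= v vn; rewrite insubT /= permE.
by apply/eq_in_map => e /(wf_point wd) [e1 e2]; rewrite !H.
Qed.

Lemma comp_iso X Y Z f f' g g' :
    wf X Y f -> wf X Y f' -> wf Y Z g -> wf Y Z g' ->
  iso f f' -> iso g g' -> iso (comp_graph (size Y) g f) (comp_graph (size Y) g' f').
Proof.
move=> wf_f wf_f' wf_g wf_g' /and3P[/eqP nf /eqP cf /existsP[s sE]].
case/and3P => /eqP ng /eqP cg /existsP[t tE].
pose n := (nvert f + nvert g)%N.
pose h v := if (v < nvert f)%N then perm_fun s v
            else if (v < n)%N then (nvert f + perm_fun t (v - nvert f))%N else v.
have hlt v : (v < n)%N -> (h v < n)%N.
  move=> vn; rewrite /h; case: ifP => [vf|/negbT].
    by rewrite ltn_addr // perm_fun_lt.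
  by rewrite -leqNgt vn => fv; rewrite ltn_add2l perm_fun_lt ltn_subLR.
have hltf v : (h v < nvert f)%N = (v < nvert f)%N.
  rewrite /h; case: ifP => [vf|/negbT]; first by rewrite perm_fun_lt.
  rewrite -leqNgt => fv; case: ifP => vn; last by rewrite ltnNge fv.
  by rewrite ltnNge leq_addr.
have hge v : (n <= v)%N -> h v = v.
  move=> nv; rewrite /h ltnNge (leq_trans (leq_addr _ _) nv) /=.
  by rewrite ltnNge nv.
have hI : injective h.
  move=> u v E; have := hltf u; rewrite E hltf.
  have [un|nu] := ltnP u n; last first.
    have [vn|nv] := ltnP v n; last by rewrite -(hge _ nu) E hge.
    by move: (hlt _ vn); rewrite -E hge // ltnNge nu.
  have [vn|nv] := ltnP v n; last first.
    by move: (hlt _ un); rewrite E hge // ltnNge nv.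
  move=> uv; move: E; rewrite /h un vn uv.
  case: ifP => uf; first exact: perm_fun_inj.
  rewrite uf in uv; move=> /addnI/perm_fun_inj => E.
  by rewrite -(subnKC (n := u) (m := nvert f)) 1?leqNgt ?uf // E subnKC // leqNgt uv.
have mapf : map_points (map_vtx h) (map_points (cod_to_vtx n) (edges f)) =
            map_points (cod_to_vtx n) (map_points (perm_vtx s) (edges f)).
  rewrite !map_points_comp; apply/eq_in_map => e /(wf_point wf_f) [e1 e2].
  have H x : is_point X Y (nvert f) x ->
      (map_vtx h \o cod_to_vtx n) x = (cod_to_vtx n \o perm_vtx s) x.
    rewrite /= perm_vtxE; case: x => //= v vP; first by rewrite hge // leq_addr.
    by rewrite /h vP.
  by rewrite !H.
have mapg : map_points (map_vtx h) (map_points (dom_to_vtx (nvert f) n) (edges g)) =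
            map_points (dom_to_vtx (nvert f) n) (map_points (perm_vtx t) (edges g)).
  rewrite !map_points_comp; apply/eq_in_map => e /(wf_point wf_g) [e1 e2].
  have H x : is_point Y Z (nvert g) x ->
      (map_vtx h \o dom_to_vtx (nvert f) n) x =
      (dom_to_vtx (nvert f) n \o perm_vtx t) x.
    rewrite /= perm_vtxE; case: x => //= v vP; first by rewrite hge // leq_addr.
    by rewrite /h ltnNge leq_addr /= ltn_add2l vP addKn.
  by rewrite !H.
have wfc := comp_wf wf_f wf_g.
move: (wfc); rewrite /comp_graph -nf -ng -cf -cg -/n.
set E := _ ++ _; set E' := _ ++ _; set mid := [seq _ | _ <- iota _ _].
have EE' : perm_eq (map_points (map_vtx h) E) E'.
  rewrite /E /map_points map_cat; apply: perm_cat.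
    by rewrite [X in perm_eq X _]mapf; apply: perm_map_points.
  by rewrite [X in perm_eq X _]mapg; apply: perm_map_points.
have hmid : map (map_vtx h) mid = mid.
  by rewrite -map_comp; apply: eq_map => j /=; rewrite hge // leq_addr.
have := foldr_smooth_perm mid (ncirc f + ncirc g)%N EE'.
rewrite -{1 3}hmid foldr_smooth_map; last exact: map_vtx_inj.
case: (foldr _ _ _) => F c; case: (foldr _ _ _) => F' c' /= [FF' cc'] wF.
apply: (@iso_map (Graph n F c) (Graph n F' c') h hI hlt erefl cc' _ FF').
by exists X, Z.
Qed.

Lemma tens_iso X Y X' Y' f f' g g' :
    wf X Y f -> wf X Y f' -> wf X' Y' g -> wf X' Y' g' ->
    iso f f' -> iso g g' ->
  iso (tens_graph (size X) (size Y) f g) (tens_graph (size X) (size Y) f' g').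
Proof.
move=> wf_f wf_f' wf_g wf_g' /and3P[/eqP nf /eqP cf /existsP[s sE]].
case/and3P => /eqP ng /eqP cg /existsP[t tE].
pose h v := if (v < nvert f)%N then perm_fun s v
            else (nvert f + perm_fun t (v - nvert f))%N.
have hltf v : (h v < nvert f)%N = (v < nvert f)%N.
  rewrite /h; case: ifP => [vf|/negbT]; first by rewrite perm_fun_lt.
  by rewrite -leqNgt => fv; rewrite ltnNge leq_addr.
have hI : injective h.
  move=> u v E; have := hltf u; rewrite E hltf.
  move=> uv; move: E; rewrite /h uv.
  case: ifP => uf; first exact: perm_fun_inj.
  rewrite uf in uv; move=> /addnI/perm_fun_inj => E.
  by rewrite -(subnKC (n := u) (m := nvert f)) 1?leqNgt ?uf // E subnKC // leqNgt uv.
apply: (iso_map hI) => /=.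
- move=> v vn; rewrite /h; case: ifP => [vf|/negbT].
    by rewrite ltn_addr // perm_fun_lt.
  by rewrite -leqNgt => fv; rewrite ltn_add2l perm_fun_lt ltn_subLR.
- by rewrite nf ng.
- by rewrite cf cg.
- by exists (X ++ X'), (Y ++ Y'); apply: tens_wf.
rewrite /map_points map_cat; apply: perm_cat.
  suff -> : [seq (map_vtx h e.1, map_vtx h e.2) | e <- edges f] =
            map_points (perm_vtx s) (edges f) by [].
  apply/eq_in_map => e /(wf_point wf_f) [e1 e2].
  have H x : is_point X Y (nvert f) x -> map_vtx h x = perm_vtx s x.
    by rewrite perm_vtxE; case: x => //= v vP; rewrite /h vP.
  by rewrite !H.
apply: perm_trans (perm_map_points
  (fun p => dom_shift p (size X) (size Y) (nvert f')) tE).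
suff <- : map_points (map_vtx h) (map_points
            (fun p => dom_shift p (size X) (size Y) (nvert f)) (edges g)) =
  map_points (fun p => dom_shift p (size X) (size Y) (nvert f'))
    (map_points (perm_vtx t) (edges g)) by [].
rewrite !map_points_comp; apply/eq_map_points => x.
rewrite /= perm_vtxE; case: x => //= v; rewrite -nf.
by rewrite /h ltnNge leq_addr /= addKn.
Qed.


Definition class X Y (d : diag X Y) : hom X Y := \pi_(hom X Y) d.

Lemma classP X Y (d d' : diag X Y) : reflect (class d = class d') (iso d d').
Proof. by apply: (iffP idP) => [?|/eqmodP]; first exact/eqmodP. Qed.

Lemma repr_iso X Y (d : diag X Y) : iso (repr (class d)) d.
Proof. by apply/classP; rewrite /class reprK. Qed.

Definition comp_diag X Y Z (g : diag Y Z) (f : diag X Y) : diag X Z :=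
  Diag (comp_wf (diag_wf f) (diag_wf g)).

Definition tens_diag X Y X' Y' (f : diag X Y) (g : diag X' Y') :
    diag (X ++ X') (Y ++ Y') :=
  Diag (tens_wf (diag_wf f) (diag_wf g)).

(* Lifted along representatives; compatible with [iso] by [comp_homE] and
   [tens_homE]. *)
Definition comp_hom X Y Z (g : hom Y Z) (f : hom X Y) : hom X Z :=
  class (comp_diag (repr g) (repr f)).

Definition tens_hom X Y X' Y' (f : hom X Y) (g : hom X' Y') :
    hom (X ++ X') (Y ++ Y') :=
  class (tens_diag (repr f) (repr g)).

Lemma comp_homE X Y Z (g : diag Y Z) (f : diag X Y) :
  comp_hom (class g) (class f) = class (comp_diag g f).
Proof.
apply/classP; have H := (comp_iso (diag_wf _) (diag_wf _) (diag_wf _) (diag_wf _)).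
by apply: H; apply: repr_iso.
Qed.

Lemma tens_homE X Y X' Y' (f : diag X Y) (g : diag X' Y') :
  tens_hom (class f) (class g) = class (tens_diag f g).
Proof.
apply/classP; have H := (tens_iso (diag_wf _) (diag_wf _) (diag_wf _) (diag_wf _)).
by apply: H; apply: repr_iso.
Qed.


Section Linearization.
Variable k : comPzRingType.

Section FreeModule.
Variable K : choiceType.
Implicit Types (c : k) (x y : {malg k[K]}) (a : K).

Definition malg_scale c x : {malg k[K]} :=
  \sum_(a <- msupp x) << c * x@_a *g a >>.

Lemma malg_scaleE c x a : (malg_scale c x)@_a = c * x@_a.
Proof.
rewrite {2}[x]monalgE !raddf_sum mulr_sumr.
by apply/eq_bigr=> /= i _; rewrite !mcoeffU mulrnAr.
Qed.

Lemma malg_scaleA c c' x : malg_scale c (malg_scale c' x) = malg_scale (c * c') x.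
Proof. by apply/malgP => a; rewrite !malg_scaleE mulrA. Qed.

Lemma malg_scale1 : left_id 1 malg_scale.
Proof. by move=> x; apply/malgP => a; rewrite !malg_scaleE mul1r. Qed.

Lemma malg_scaleDr : right_distributive malg_scale +%R.
Proof.
by move=> c x y; apply/malgP => a; rewrite !(mcoeffD, malg_scaleE) mulrDr.
Qed.

Lemma malg_scaleDl x : {morph malg_scale^~ x : c c' / c + c'}.
Proof.
by move=> c c'; apply/malgP => a; rewrite !(mcoeffD, malg_scaleE) mulrDl.
Qed.

End FreeModule.

(* The free k-module on [hom X Y]. The scaling is not the one of the monalg
   library because the latter requires k to be nontrivial. *)
Definition linhom (X Y : object) := {malg k[hom X Y]}.

HB.instance Definition _ X Y := GRing.Zmodule.on (linhom X Y).
HB.instance Definition _ X Y := GRing.Zmodule_isLmodule.Build k (linhom X Y)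
  (@malg_scaleA (hom X Y)) (@malg_scale1 (hom X Y))
  (@malg_scaleDr (hom X Y)) (@malg_scaleDl (hom X Y)).

Definition lin_diag X Y (d : diag X Y) : linhom X Y := << class d >>.

Definition lin_comp X Y Z (g : linhom Y Z) (f : linhom X Y) : linhom X Z :=
  \sum_(b <- msupp g) \sum_(a <- msupp f) << g@_b * f@_a *g comp_hom b a >>.

Definition lin_tens X Y X' Y' (f : linhom X Y) (g : linhom X' Y') :
    linhom (X ++ X') (Y ++ Y') :=
  \sum_(a <- msupp f) \sum_(b <- msupp g) << f@_a * g@_b *g tens_hom a b >>.


Record tensor_ideal (I : forall X Y, linhom X Y -> Prop) : Prop := {
  tensor_ideal0 : forall X Y, I X Y 0;
  tensor_idealD : forall X Y (x y : linhom X Y), I X Y x -> I X Y y -> I X Y (x + y);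
  tensor_idealZ : forall X Y (c : k) (x : linhom X Y), I X Y x -> I X Y (c *: x);
  tensor_ideal_compl : forall X Y Z (g : linhom Y Z) (f : linhom X Y),
    I X Y f -> I X Z (lin_comp g f);
  tensor_ideal_compr : forall X Y Z (g : linhom Y Z) (f : linhom X Y),
    I Y Z g -> I X Z (lin_comp g f);
  tensor_ideal_tensl : forall X Y X' Y' (f : linhom X Y) (g : linhom X' Y'),
    I X' Y' g -> I (X ++ X') (Y ++ Y') (lin_tens f g);
  tensor_ideal_tensr : forall X Y X' Y' (f : linhom X Y) (g : linhom X' Y'),
    I X Y f -> I (X ++ X') (Y ++ Y') (lin_tens f g)
}.

Definition generated_ideal (R : forall X Y, linhom X Y -> Prop)
    (X Y : object) (x : linhom X Y) : Prop :=
  forall I : (forall X Y, linhom X Y -> Prop), tensor_ideal I ->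
    (forall X Y (r : linhom X Y), R X Y r -> I X Y r) -> I X Y x.

End Linearization.


Local Notation "1^ n" := (nseq n true) (at level 2, format "1^ n").

Definition empty_diag : diag [::] [::] := @Diag [::] [::] (Graph 0 [::] 0) isT.

Definition circle_diag : diag [::] [::] := @Diag [::] [::] (Graph 0 [::] 1) isT.

(* [W_(ij|kl)] and [V_i], where [j], [k], [l] are the indices other than [i].
   The boundary points are [b_0 = Dom 0] and [b_(i+1) = Cod i]. *)
Definition tree_graph (i j k l : nat) : graph :=
  Graph 3 [:: (Dom 0, Vtx 0); (Vtx 1, Vtx 0); (Vtx 2, Vtx 0);
              (Vtx 1, Cod i); (Vtx 1, Cod j);
              (Vtx 2, Cod k); (Vtx 2, Cod l)] 0.

Definition fork_graph (i j k l : nat) : graph :=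
  Graph 1 [:: (Dom 0, Cod i);
              (Vtx 0, Cod j); (Vtx 0, Cod k); (Vtx 0, Cod l)] 0.

Definition W12_34 := @Diag 1^1 1^4 (tree_graph 0 1 2 3) isT.
Definition W13_24 := @Diag 1^1 1^4 (tree_graph 0 2 1 3) isT.
Definition W14_23 := @Diag 1^1 1^4 (tree_graph 0 3 1 2) isT.
Definition V1 := @Diag 1^1 1^4 (fork_graph 0 1 2 3) isT.
Definition V2 := @Diag 1^1 1^4 (fork_graph 1 0 2 3) isT.
Definition V3 := @Diag 1^1 1^4 (fork_graph 2 0 1 3) isT.
Definition V4 := @Diag 1^1 1^4 (fork_graph 3 0 1 2) isT.

Definition arc_diag := @Diag 1^1 1^1 (Graph 0 [:: (Dom 0, Cod 0)] 0) isT.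

(* The source is [Vtx 0], the sink is [Vtx 1]. *)
Definition bigon_diag := @Diag 1^1 1^1
  (Graph 2 [:: (Dom 0, Vtx 1); (Vtx 0, Vtx 1); (Vtx 0, Vtx 1);
               (Vtx 0, Cod 0)] 0) isT.

(* The sinks are [Vtx 0] and [Vtx 1], the sources are [Vtx 2] and [Vtx 3]. *)
Definition square_diag := @Diag 1^2 1^2
  (Graph 4 [:: (Vtx 2, Vtx 0); (Vtx 2, Vtx 1); (Vtx 3, Vtx 0); (Vtx 3, Vtx 1);
               (Dom 0, Vtx 0); (Dom 1, Vtx 1);
               (Vtx 2, Cod 0); (Vtx 3, Cod 1)] 0) isT.

(* The source is [Vtx 0], the sink is [Vtx 1]. *)
Definition A_diag := @Diag 1^2 1^2
  (Graph 2 [:: (Vtx 0, Vtx 1); (Dom 0, Vtx 1); (Dom 1, Vtx 1);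
               (Vtx 0, Cod 0); (Vtx 0, Cod 1)] 0) isT.

Definition I_diag := @Diag 1^2 1^2
  (Graph 0 [:: (Dom 0, Cod 0); (Dom 1, Cod 1)] 0) isT.

Definition U_diag := @Diag 1^2 1^2
  (Graph 0 [:: (Dom 0, Cod 1); (Dom 1, Cod 0)] 0) isT.

Inductive E_relation (k : comPzRingType) (n : k) :
    forall X Y : object, linhom k X Y -> Prop :=
| seven_term_relation :
    E_relation n
      (lin_diag k W12_34 + lin_diag k W13_24 + lin_diag k W14_23
       - (6 *: lin_diag k V1 + 6 *: lin_diag k V2
          + 6 *: lin_diag k V3 + 6 *: lin_diag k V4))
| circle_relation :
    E_relation n (lin_diag k circle_diag - n *: lin_diag k empty_diag)
| bigon_relation :
    E_relation n
      (lin_diag k bigon_diag - (2 * (n + 3)) *: lin_diag k arc_diag)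
| square_relation :
    E_relation n
      (lin_diag k square_diag
       - ((3 - n) *: lin_diag k A_diag + (6 * (n + 3)) *: lin_diag k I_diag
          + (6 * (n + 3)) *: lin_diag k U_diag)).


Definition pE : {poly Zinv6} :=
  ('X - 27%:P) * ('X - 15%:P) * ('X - 9%:P) * ('X - 6%:P) * ('X - 3%:P) ^+ 2
  * ('X - 1%:P) * 'X ^+ 2 * ('X + 1%:P) * ('X + 3%:P) ^+ 2.

Lemma pE_monic : pE \is monic.
Proof.
by rewrite /pE; do ?[apply: rpredM|apply: rpredX];
  rewrite ?monicX ?monicXsubC ?monicXaddC.
Qed.

(* Main.v *)
From Stdlib Require Import ZArith.
Require Import Defs.
From mathcomp Require Import all_boot all_order all_fingroup all_algebra.
From mathcomp Require Import generic_quotient finmap monalg ssrZ.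

(** Modulo the ideal every closed graph met below becomes a polynomial in [n]
    times the empty graph, and one graph does so in two different ways.

    Bigons and squares are removed by their reduction rules. In a graph
    without them, let [v1 -> v0 <- v2] be a path with sources [v1], [v2]
    contained in a hexagon. The seven-term relation at this path expresses the
    graph through two other pairings of the four outer edges of [v1], [v2] and
    four graphs with fewer vertices. One of the pairings shortens the hexagon
    to a square, and if the path is well chosen the other pairing shortens
    another hexagon, or gives a graph evaluated before. In this way graphs of
    growing size are evaluated one after another.

    The choice of the path matters for graphs with 22 vertices. For the
    incidence graph of a certain configuration of 11 points and 11 lines (three
    points on each line, three lines through each point), which has girth 6,
    two paths lead to values that differ by [288 pE(n)]. Hence [288 pE(n)]
    times the empty graph lies in the ideal, and 288 is a unit because 6 is.

    The evaluation is carried out by a verified program. A rule is plugged into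
    a closed context by composing with the context and with a coevaluation
    ([closure_diag]); this operation is computable on concrete graphs, and by
    [lin_closure_ideal] it sends relations to elements of the ideal. A [step]
    lists a rule, a context, and for each term on the right-hand side an
    isomorphism with a graph whose value is known, so that [run] computes the
    value of the left-hand side; [run_valid] is its soundness, [steps] the list
    for the graph above and [two_evaluations] the resulting difference. *)

Set Implicit Arguments.
Unset Strict Implicit.
Unset Printing Implicit Defensive.

Import GRing.Theory.
Local Open Scope ring_scope.
Delimit Scope Z_scope with BZ.

(** * Linear extensions of maps between sets of diagrams *)

Section PushForward.
Variable k : comPzRingType.

Definition push (X Y X' Y' : object) (phi : Defs.hom X Y -> Defs.hom X' Y')
    (x : linhom k X Y) : linhom k X' Y' :=
  \sum_(a <- msupp x) << x@_a *g phi a >>.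

(** Enlarging the index set makes sums over the supports of [x], [y] and
    [x + y] comparable. *)
Lemma pushEw (X Y X' Y' : object) (phi : Defs.hom X Y -> Defs.hom X' Y')
    (x : linhom k X Y) (d : {fset Defs.hom X Y}) :
  (msupp x `<=` d)%fset -> push phi x = \sum_(a <- d) << x@_a *g phi a >>.
Proof.
move=> xd; apply: big_fset_incl => // a _ /mcoeff_outdom ->.
by rewrite monalgU0.
Qed.

Lemma pushD (X Y X' Y' : object) (phi : Defs.hom X Y -> Defs.hom X' Y') :
  {morph push phi : x y / x + y}.
Proof.
move=> x y; have sxy := msuppD_le x y.
rewrite (pushEw _ sxy) (pushEw _ (fsubsetUl (msupp x) (msupp y))).
rewrite (pushEw _ (fsubsetUr (msupp x) (msupp y))) -big_split /=.
by apply: eq_bigr => a _; rewrite mcoeffD monalgUD.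
Qed.

Lemma lin_scaleE (X Y : object) c (x : linhom k X Y) a :
  (c *: x)@_a = c * x@_a.
Proof. exact: malg_scaleE. Qed.

Lemma lin_scaleU (X Y : object) c z (a : Defs.hom X Y) :
  c *: (<< z *g a >> : linhom k X Y) = << c * z *g a >>.
Proof.
apply/malgP => b.
have E y : (<< y *g a >> : linhom k X Y)@_b = y *+ (a == b).
  exact: mcoeffU.
apply: (etrans (lin_scaleE c _ b)).
apply: (etrans (congr1 ( *%R c) (E z))).
apply: (etrans (mulrnAr _ _ _)).
exact: (esym (E _)).
Qed.

Lemma pushZ (X Y X' Y' : object) (phi : Defs.hom X Y -> Defs.hom X' Y') c :
  {morph push phi : x / c *: x}.
Proof.
move=> x; have sx : (msupp (c *: x) `<=` msupp x)%fset.
  apply/fsubsetP => a; rewrite -!mcoeff_neq0 lin_scaleE.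
  by apply: contraNneq => ->; rewrite mulr0.
rewrite (pushEw _ sx) /push scaler_sumr; apply: eq_bigr => a _.
by rewrite lin_scaleU lin_scaleE.
Qed.

Lemma pushU (X Y X' Y' : object) (phi : Defs.hom X Y -> Defs.hom X' Y') a :
  push phi << a >> = << phi a >>.
Proof. by rewrite (pushEw _ msuppU_le) big_seq_fset1 mcoeffUU. Qed.

Lemma comp_pushl (X Y Z : object) (b : Defs.hom Y Z) (f : linhom k X Y) :
  lin_comp << b >> f = push (comp_hom b) f.
Proof.
rewrite /lin_comp (big_fset_incl _ msuppU_le) /=; last first.
  move=> c _ /mcoeff_outdom ->; apply: big1 => a _.
  by rewrite mul0r monalgU0.
by rewrite big_seq_fset1; apply: eq_bigr => a _; rewrite mcoeffUU mul1r.
Qed.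

Lemma comp_pushr (X Y Z : object) (g : linhom k Y Z) (a : Defs.hom X Y) :
  lin_comp g << a >> = push (fun b => comp_hom b a) g.
Proof.
rewrite /lin_comp; apply: eq_bigr => b _; rewrite (big_fset_incl _ msuppU_le) /=.
  by rewrite big_seq_fset1 mcoeffUU mulr1.
by move=> c _ /mcoeff_outdom ->; rewrite mulr0 monalgU0.
Qed.

Lemma tens_pushr (X Y X' Y' : object) (f : linhom k X Y) (b : Defs.hom X' Y') :
  lin_tens f << b >> = push (fun a => tens_hom a b) f.
Proof.
rewrite /lin_tens; apply: eq_bigr => a _; rewrite (big_fset_incl _ msuppU_le) /=.
  by rewrite big_seq_fset1 mcoeffUU mulr1.
by move=> c _ /mcoeff_outdom ->; rewrite mulr0 monalgU0.
Qed.

End PushForward.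

(** * Closing up a diagram *)

Section Closing.
Variables (k : comPzRingType) (n : k).
Let I := generated_ideal (@E_relation k n).

Lemma generated_ideal_tensor : tensor_ideal (fun X Y => @I X Y).
Proof.
split=> [X Y|X Y x y Ix Iy|X Y c x Ix|X Y Z g f If|X Y Z g f Ig
         |X Y X' Y' f g Ig|X Y X' Y' f g If] J J_ideal RJ.
- exact: tensor_ideal0.
- by apply: tensor_idealD => //; [apply: Ix|apply: Iy].
- by apply: tensor_idealZ => //; apply: Ix.
- by apply: tensor_ideal_compl => //; apply: If.
- by apply: tensor_ideal_compr => //; apply: Ig.
- by apply: tensor_ideal_tensl => //; apply: Ig.
- by apply: tensor_ideal_tensr => //; apply: If.
Qed.

(** The closure of [d : X -> Y] is [ctx o (d (x) strands) o opening]. With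
    [Z] dual to [X], [strands] the identity and [opening] the coevaluation, every
    closed graph that contains [d] is of this form for a suitable [ctx]. *)
Definition closure_diag X Y Z (ctx : diag (Y ++ Z) [::]) (strands : diag Z Z)
    (opening : diag [::] (X ++ Z)) (d : diag X Y) : diag [::] [::] :=
  comp_diag ctx (comp_diag (tens_diag d strands) opening).

Definition lin_closure X Y Z (ctx : diag (Y ++ Z) [::]) (strands : diag Z Z)
    (opening : diag [::] (X ++ Z)) (x : linhom k X Y) : linhom k [::] [::] :=
  lin_comp (lin_diag k ctx)
    (lin_comp (lin_tens x (lin_diag k strands)) (lin_diag k opening)).

Lemma lin_closure_push (X Y Z : object) ctx strands opening (x : linhom k X Y) :
  @lin_closure X Y Z ctx strands opening x =
  push (comp_hom (Defs.class ctx)) (push (fun b => comp_hom b (Defs.class opening))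
    (push (fun a => tens_hom a (Defs.class strands)) x)).
Proof. by rewrite /lin_closure comp_pushl comp_pushr tens_pushr. Qed.

Lemma lin_closureD (X Y Z : object) ctx strands opening :
  {morph @lin_closure X Y Z ctx strands opening : x y / x + y}.
Proof. by move=> x y; rewrite !lin_closure_push !pushD. Qed.

Lemma lin_closureZ (X Y Z : object) ctx strands opening c :
  {morph @lin_closure X Y Z ctx strands opening : x / c *: x}.
Proof. by move=> x; rewrite !lin_closure_push !pushZ. Qed.

Lemma lin_closureB (X Y Z : object) ctx strands opening :
  {morph @lin_closure X Y Z ctx strands opening : x y / x - y}.
Proof.
by move=> x y; rewrite -scaleN1r lin_closureD lin_closureZ scaleN1r.
Qed.

Lemma lin_closure_diag (X Y Z : object) ctx strands opening (d : diag X Y) :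
  @lin_closure X Y Z ctx strands opening (lin_diag k d) =
  lin_diag k (closure_diag ctx strands opening d).
Proof.
by rewrite lin_closure_push /lin_diag !pushU tens_homE !comp_homE.
Qed.

Lemma lin_closure_ideal (X Y Z : object) ctx strands opening x :
  I x -> I (@lin_closure X Y Z ctx strands opening x).
Proof.
have T := generated_ideal_tensor => Ix.
by apply: (tensor_ideal_compl T); apply: (tensor_ideal_compr T);
   apply: (tensor_ideal_tensr T).
Qed.
End Closing.

(** * Polynomials with binary integer coefficients, constant term first *)

Definition zpoly := seq Z.

Fixpoint zpoly_add (p q : zpoly) : zpoly :=
  match p, q with
  | [::], _ => q
  | _, [::] => p
  | a :: p', b :: q' => Z.add a b :: zpoly_add p' q'
  end.

Definition zpoly_scale (a : Z) (p : zpoly) : zpoly := [seq Z.mul a b | b <- p].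

Definition zpoly_mul (p q : zpoly) : zpoly :=
  foldr (fun a r => zpoly_add (zpoly_scale a q) (Z0 :: r)) [::] p.

Section Evaluation.
Variables (k : comPzRingType) (n : k).

Definition zpoly_eval (p : zpoly) : k :=
  foldr (fun a x => (int_of_Z a)%:~R + n * x) 0 p.

Lemma zpoly_evalD p q : zpoly_eval (zpoly_add p q) = zpoly_eval p + zpoly_eval q.
Proof.
elim: p q => [|a p IH] [|b q] //=; rewrite ?add0r ?addr0 // IH.
by rewrite (rmorphD int_of_Z a b) rmorphD mulrDr addrACA.
Qed.

Lemma zpoly_evalZ a p :
  zpoly_eval (zpoly_scale a p) = (int_of_Z a)%:~R * zpoly_eval p.
Proof.
elim: p => [|b p IH] /=; first by rewrite mulr0.
by rewrite IH (rmorphM int_of_Z a b) rmorphM mulrDr mulrCA.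
Qed.

Lemma zpoly_evalM p q : zpoly_eval (zpoly_mul p q) = zpoly_eval p * zpoly_eval q.
Proof.
elim: p => [|a p IH] /=; first by rewrite mul0r.
by rewrite zpoly_evalD zpoly_evalZ /= IH add0r mulrDl mulrA.
Qed.

Lemma zpoly_eval_prod ps :
  zpoly_eval (foldr zpoly_mul [:: 1%BZ] ps) = \prod_(p <- ps) zpoly_eval p.
Proof.
elim: ps => [|p ps IH]; last by rewrite big_cons -IH -zpoly_evalM.
by rewrite big_nil -[LHS]/(1 + n * 0) mulr0 addr0.
Qed.

End Evaluation.

(** * Isomorphisms given by a list of vertices *)

(** Numbers outside the list are fixed, so that [relabel s] is injective on all
    of [nat] when [s] enumerates an initial segment. *)
Definition relabel (s : seq nat) (v : nat) : nat := nth v s v.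

Definition relabels (s : seq nat) (g h : graph) : bool :=
  [&& uniq s, size s == nvert g, all (fun v => v < nvert g)%N s,
      nvert g == nvert h, ncirc g == ncirc h
    & perm_eq (map_points (map_vtx (relabel s)) (edges g)) (edges h)].

Lemma relabels_iso X Y s g h : wf X Y g -> relabels s g h -> iso g h.
Proof.
move=> wg /and5P[us /eqP ss /allP sn /eqP gh /andP[/eqP cc pe]].
have lt v : (v < nvert g)%N -> (relabel s v < nvert g)%N.
  by move=> vn; apply: sn; rewrite mem_nth // ss.
have ge v : (nvert g <= v)%N -> relabel s v = v.
  by move=> nv; rewrite /relabel nth_default // ss.
apply: (@iso_map _ _ (relabel s)) => //; last by exists X, Y.
move=> u v E; have [un|nu] := ltnP u (nvert g); have [vn|nv] := ltnP v (nvert g).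
- move: E; rewrite /relabel (set_nth_default v) ?ss // => /eqP.
  by rewrite nth_uniq ?ss // => /eqP.
- by have := lt _ un; rewrite E ge // ltnNge nv.
- by have := lt _ vn; rewrite -E ge // ltnNge nu.
- by rewrite -(ge u) // E ge.
Qed.

(** * The rules *)

(** [rside] is the dual of [rdom], [rstrands] is the identity of this dual and
    [ropening] the coevaluation; [rrhs] lists the terms that replace [rlhs]. *)
Record rule := Rule {
  rdom : object;
  rcod : object;
  rside : object;
  ropening : diag [::] (rdom ++ rside);
  rstrands : diag rside rside;
  rlhs : diag rdom rcod;
  rrhs : seq (zpoly * diag rdom rcod) }.

(** The graph underlying [closure_diag], for a context [c] not yet known to be
    well formed. *)
Definition closed_graph (r : rule) (c : graph) (d : graph) : graph :=
  comp_graph (size (rcod r ++ rside r)) c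
    (comp_graph (size (rdom r ++ rside r))
      (tens_graph (size (rdom r)) (size (rcod r)) d (rstrands r)) (ropening r)).

Local Notation "1^ n" := (nseq n true) (at level 2, format "1^ n").
Local Notation "0^ n" := (nseq n false) (at level 2, format "0^ n").

Definition circle_rule := @Rule [::] [::] [::] empty_diag empty_diag circle_diag
  [:: ([:: 0; 1]%BZ, empty_diag)].

Definition cup1 := @Diag [::] (1^1 ++ 0^1) (Graph 0 [:: (Cod 1, Cod 0)] 0) isT.
Definition cup2 := @Diag [::] (1^2 ++ 0^2)
  (Graph 0 [:: (Cod 2, Cod 0); (Cod 3, Cod 1)] 0) isT.
Definition down1 := @Diag 0^1 0^1 (Graph 0 [:: (Cod 0, Dom 0)] 0) isT.
Definition down2 := @Diag 0^2 0^2
  (Graph 0 [:: (Cod 0, Dom 0); (Cod 1, Dom 1)] 0) isT.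

Definition bigon_rule := @Rule 1^1 1^1 0^1 cup1 down1 bigon_diag
  [:: ([:: 6; 2]%BZ, arc_diag)].

Definition square_rule := @Rule 1^2 1^2 0^2 cup2 down2 square_diag
  [:: ([:: 3; -1]%BZ, A_diag); ([:: 18; 6]%BZ, I_diag); ([:: 18; 6]%BZ, U_diag)].

Definition seven_rule := @Rule 1^1 1^4 0^1 cup1 down1 W12_34
  [:: ([:: -1]%BZ, W13_24); ([:: -1]%BZ, W14_23);
      ([:: 6]%BZ, V1); ([:: 6]%BZ, V2); ([:: 6]%BZ, V3); ([:: 6]%BZ, V4)].

Variant relation := Circle | Bigon | Square | Seven.

Definition rule_of (e : relation) : rule :=
  match e with
  | Circle => circle_rule
  | Bigon => bigon_rule
  | Square => square_rule
  | Seven => seven_rule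
  end.

(** * Running a list of evaluation steps *)

(** The first [b] points of the context are its boundary points and the others
    its [svert] vertices. The [i]-th entry of [srows] lists the heads of the
    edges that leave point [i]; trailing empty lists are omitted. Each element of
    [sterms] belongs to one term of the right-hand side of the rule: the
    position in the table of a graph of known value, and the relabelling of
    the vertices that carries the closed-up term to this graph. In a closed-up
    graph the vertices of the rule come before those of the context. *)
Record step := Step {
  srel : relation;
  svert : nat;
  srows : seq (seq nat);
  sterms : seq (nat * seq nat) }.

Definition row_point (b i : nat) : point := if (i < b)%N then Dom i else Vtx (i - b).

Definition step_context (s : step) : graph :=
  let r := rule_of (srel s) in
  let b := size (rcod r ++ rside r) in
  let rows := srows s in
  Graph (svert s)
    [seq (row_point b i, row_point b j) | i <- iota 0 (size rows),
                                          j <- nth [::] rows i] 0.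

Definition table := seq (graph * zpoly).

Definition empty_entry : graph * zpoly := (Graph 0 [::] 0, [:: 1%BZ]).

Definition entry (T : table) (i : nat) : graph * zpoly := nth empty_entry T i.

Fixpoint terms_value (T : table) (close : graph -> graph) X Y
    (ts : seq (zpoly * diag X Y)) (us : seq (nat * seq nat)) : option zpoly :=
  match ts, us with
  | [::], [::] => Some [::]
  | t :: ts', u :: us' =>
      let: (g, p) := entry T u.1 in
      if relabels u.2 (close t.2) g then
        omap (zpoly_add (zpoly_mul t.1 p)) (terms_value T close ts' us')
      else None
  | _, _ => None
  end.

Definition run_step (T : option table) (s : step) : option table :=
  if T is Some T then
    let r := rule_of (srel s) in
    let c := step_context s in
    if wf (rcod r ++ rside r) [::] c then
      omap (fun p => rcons T (closed_graph r c (rlhs r), p))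
           (terms_value T (fun d => closed_graph r c d) (rrhs r) (sterms s))
    else None
  else None.

Definition run (ss : seq step) : option table :=
  foldl run_step (Some [:: empty_entry]) ss.

(** The values found for the entries [i] and [j], provided that [s] is an
    isomorphism between their graphs. *)
Definition two_values (ss : seq step) (i j : nat) (s : seq nat) :
    option (zpoly * zpoly) :=
  if run ss is Some T then
    if relabels s (entry T i).1 (entry T j).1
    then Some ((entry T i).2, (entry T j).2) else None
  else None.

(** * Soundness of the evaluation *)

Section Soundness.
Variables (k : comPzRingType) (n : k).
Let I := generated_ideal (@E_relation k n).
Let T := generated_ideal_tensor n.

Definition lin_comb (X Y : object) (ts : seq (zpoly * diag X Y)) : linhom k X Y :=
  foldr (fun t x => zpoly_eval n t.1 *: lin_diag k t.2 + x) 0 ts.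

Definition rule_relation (r : rule) : linhom k (rdom r) (rcod r) :=
  lin_diag k (rlhs r) - lin_comb (rrhs r).

(** The coefficients of the rules agree with those of the relations. The next
    four lemmas say so for arbitrary vectors in place of the diagrams, so that
    simplification cannot unfold the diagrams. *)
Lemma circle_rule_coefs (V : lmodType k) (x y : V) :
  x - (zpoly_eval n [:: 0; 1]%BZ *: y + 0) = x - n *: y.
Proof.
by rewrite -[zpoly_eval _ _]/(0 + n * (1 + n * 0)) mulr0 !addr0 mulr1 add0r.
Qed.

Lemma bigon_rule_coefs (V : lmodType k) (x y : V) :
  x - (zpoly_eval n [:: 6; 2]%BZ *: y + 0) = x - (2 * (n + 3)) *: y.
Proof.
rewrite -[zpoly_eval _ _]/(6 + n * (2 + n * 0)) mulr0 !addr0.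
by rewrite [2 * (n + 3)]mulrDr -natrM [2 * n]mulrC [n * 2 + _]addrC.
Qed.

Lemma square_rule_coefs (V : lmodType k) (x a b c : V) :
  x - (zpoly_eval n [:: 3; -1]%BZ *: a
       + (zpoly_eval n [:: 18; 6]%BZ *: b + (zpoly_eval n [:: 18; 6]%BZ *: c + 0))) =
  x - ((3 - n) *: a + (6 * (n + 3)) *: b + (6 * (n + 3)) *: c).
Proof.
rewrite -[zpoly_eval _ [:: 3; _]%BZ]/(3 + n * (-1 + n * 0)) mulr0 addr0 mulrN1.
rewrite -[zpoly_eval _ [:: 18; _]%BZ]/(18 + n * (6 + n * 0)) mulr0 !addr0.
by rewrite [6 * (n + 3)]mulrDr -natrM [6 * n]mulrC [n * 6 + _]addrC addrA.
Qed.

Lemma seven_rule_coefs (V : lmodType k) (x y z a b c d : V) :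
  let m1 := zpoly_eval n [:: -1]%BZ in let p6 := zpoly_eval n [:: 6]%BZ in
  x - (m1 *: y + (m1 *: z + (p6 *: a + (p6 *: b + (p6 *: c + (p6 *: d + 0)))))) =
  x + y + z - (6 *: a + 6 *: b + 6 *: c + 6 *: d).
Proof.
move=> m1 p6; rewrite -[m1]/(-1 + n * 0) -[p6]/(6 + n * 0) mulr0 !addr0.
by rewrite !scaleN1r !opprD !opprK !addrA.
Qed.

Lemma rule_relation_ideal (e : relation) : I (rule_relation (rule_of e)).
Proof.
move=> J _ EJ; case: e.
- have := EJ _ _ _ (circle_relation n); congr (J _ _ _).
  exact: esym (circle_rule_coefs _ _).
- have := EJ _ _ _ (bigon_relation n); congr (J _ _ _).
  exact: esym (bigon_rule_coefs _ _).
- have := EJ _ _ _ (square_relation n); congr (J _ _ _).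
  exact: esym (square_rule_coefs _ _ _ _).
- have := EJ _ _ _ (seven_term_relation n); congr (J _ _ _).
  exact: esym (seven_rule_coefs _ _ _ _ _ _ _).
Qed.

(** Tables contain raw graphs; the diagram [d] records that [g] is well formed. *)
Definition evaluates (g : graph) (p : zpoly) : Prop :=
  exists2 d : diag [::] [::], diag_val d = g
    & I (lin_diag k d - zpoly_eval n p *: lin_diag k empty_diag).

Definition valid (t : table) : Prop :=
  forall i, evaluates (entry t i).1 (entry t i).2.

Lemma ideal_trans (x y z : linhom k [::] [::]) : I (x - y) -> I (y - z) -> I (x - z).
Proof. by move=> xy yz; rewrite -(subrKA y); apply: (tensor_idealD T). Qed.

Lemma lin_diag_iso (d d' : diag [::] [::]) : iso d d' -> lin_diag k d = lin_diag k d'.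
Proof. by move=> /classP E; rewrite /lin_diag E. Qed.

Lemma empty_evaluates : evaluates empty_entry.1 empty_entry.2.
Proof.
exists empty_diag; first by [].
by rewrite -[zpoly_eval _ _]/(1 + n * 0) mulr0 addr0 scale1r subrr;
  apply: (tensor_ideal0 T).
Qed.

Lemma valid_empty : valid [:: empty_entry].
Proof.
by case=> [|i]; rewrite /entry /= ?nth_nil; apply: empty_evaluates.
Qed.

Lemma valid_rcons t g p : valid t -> evaluates g p -> valid (rcons t (g, p)).
Proof.
move=> vt gp i; have := vt i; rewrite /entry nth_rcons.
case: ifP => _ vti; first exact: vti.
case: ifP => _; [exact: gp | exact: empty_evaluates].
Qed.

Lemma terms_value_sound t (X Y : object) (close : diag X Y -> diag [::] [::])
    (clg : graph -> graph) ts us p :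
    valid t -> (forall d : diag X Y, diag_val (close d) = clg d) ->
    terms_value t clg ts us = Some p ->
  I (lin_comb [seq (s.1, close s.2) | s <- ts]
     - zpoly_eval n p *: lin_diag k empty_diag).
Proof.
move=> vt closeE; elim: ts us p => [|s ts IH] [|u us] p //=.
  by case=> <- /=; rewrite scale0r subrr; apply: (tensor_ideal0 T).
have := vt u.1; case: (entry t u.1) => g q /= gq.
case: ifP => // rel; case E: (terms_value _ _ _ _) => [p'|] //= [<-].
rewrite zpoly_evalD zpoly_evalM scalerDl opprD addrACA.
apply: (tensor_idealD T); last exact: IH E.
case: gq => d dg dq; rewrite -scalerA -scalerBr; apply: (tensor_idealZ T).
have -> : lin_diag k (close s.2) = lin_diag k d; last exact: dq.
apply: lin_diag_iso; rewrite dg.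
by apply: (relabels_iso (diag_wf (close s.2)) (s := u.2)); rewrite closeE.
Qed.

Lemma lin_closure_comb (X Y Z : object) ctx strands opening
    (ts : seq (zpoly * diag X Y)) :
  @lin_closure k X Y Z ctx strands opening (lin_comb ts) =
  lin_comb [seq (t.1, closure_diag ctx strands opening t.2) | t <- ts].
Proof.
elim: ts => [|t ts IH] /=; first by rewrite -(scale0r 0) lin_closureZ !scale0r.
by rewrite lin_closureD lin_closureZ IH lin_closure_diag.
Qed.

(** The closure of a relation lies in the ideal; the terms on the right are
    replaced by the values of the graphs to which they are isomorphic. *)
Lemma run_step_valid t s t' : valid t -> run_step (Some t) s = Some t' -> valid t'.
Proof.
move=> vt /=; set r := rule_of _; set c := step_context s.
case: ifP => [wc|_]; last discriminate.
case E: (terms_value _ _ _ _) => [p|]; last discriminate; case=> <-.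
pose close := closure_diag (Diag wc) (rstrands r) (ropening r).
apply: valid_rcons; [exact: vt|exists (close (rlhs r)); first by []].
apply: ideal_trans (terms_value_sound (close := close) vt _ E); last by [].
have := lin_closure_ideal (Diag wc) (rstrands r) (ropening r)
  (rule_relation_ideal (srel s)).
by rewrite /rule_relation -/r lin_closureB lin_closure_comb lin_closure_diag.
Qed.

Lemma run_valid ss t : run ss = Some t -> valid t.
Proof.
rewrite /run; elim/last_ind: ss t => [|ss s IH] t /=.
  by case=> <-; apply: valid_empty.
rewrite -cats1 foldl_cat /=; case E: (foldl _ _ _) => [t0|]; last discriminate.
by apply: run_step_valid; apply: IH.
Qed.

Lemma evaluates_iso g h p q s : evaluates g p -> evaluates h q -> relabels s g h ->
  I ((zpoly_eval n p - zpoly_eval n q) *: lin_diag k empty_diag).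
Proof.
case=> d dg dp [d' dh d'q] gh.
have dd' : lin_diag k d = lin_diag k d'.
  apply: lin_diag_iso; rewrite dh.
  by apply: (relabels_iso (diag_wf d) (s := s)); rewrite dg.
rewrite dd' in dp.
have := tensor_idealD T d'q (tensor_idealZ T (-1) dp).
by rewrite scaleN1r opprB addrC subrKA -scalerBl.
Qed.

Lemma two_values_ideal ss i j s p q : two_values ss i j s = Some (p, q) ->
  I ((zpoly_eval n p - zpoly_eval n q) *: lin_diag k empty_diag).
Proof.
rewrite /two_values; case E: (run ss) => [t|]; last discriminate.
case: ifP => [rel|_]; last discriminate; case=> <- <-.
by have vt := run_valid E; apply: evaluates_iso (vt i) (vt j) rel.
Qed.

End Soundness.

(** * The polynomial *)

Definition pE_factors : seq zpoly :=
  [:: [:: -27; 1]; [:: -15; 1]; [:: -9; 1]; [:: -6; 1]; [:: -3; 1]; [:: -3; 1];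
      [:: -1; 1]; [:: 0; 1]; [:: 0; 1]; [:: 1; 1]; [:: 3; 1]; [:: 3; 1]]%BZ.

Definition pE_coefs : zpoly := foldr zpoly_mul [:: 1%BZ] pE_factors.

Lemma pE_coefsE (k : comPzRingType) (phi : {rmorphism {poly Zinv6} -> k}) :
  zpoly_eval (phi 'X) pE_coefs = phi pE.
Proof.
have zpoly_linear a :
    zpoly_eval (phi 'X) [:: a; 1%BZ] = phi 'X + (int_of_Z a)%:~R.
  by rewrite -[LHS]/(_ + phi 'X * (1 + _ * 0)) mulr0 addr0 mulr1 addrC.
rewrite /pE_coefs zpoly_eval_prod !big_cons big_nil !zpoly_linear.
have phi_sub m : phi ('X - (m%:R)%:P) = phi 'X - m%:R.
  by rewrite rmorphB polyC_natr (rmorph_nat phi).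
have phi_add m : phi ('X + (m%:R)%:P) = phi 'X + m%:R.
  by rewrite rmorphD polyC_natr (rmorph_nat phi).
have phi_sub1 : phi ('X - 1%:P) = phi 'X - 1 := phi_sub 1.
have phi_add1 : phi ('X + 1%:P) = phi 'X + 1 := phi_add 1.
rewrite /pE !expr2 !(rmorphM phi) phi_sub1 phi_add1 !phi_sub !phi_add.
by rewrite mulr1 !addr0 !mulrA.
Qed.

Lemma natr288_unit (k : comPzRingType) (phi : {rmorphism {poly Zinv6} -> k}) :
  exists u : k, u * 288%:R = 1.
Proof.
have inv6 : (6%:R^-1 : rat) \in Zinv6_pred.
  by apply/Zinv6_predP; exists 1%N; rewrite expr1 mulfV // rpred1.
pose a : Zinv6 := MkZinv6 inv6.
have a6 : a * 6%:R = 1.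
  by apply: val_inj; rewrite rmorphM rmorph_nat rmorph1 /= mulVf.
(* 288 * 27 = 6 ^ 5 *)
exists (phi (27%:R * a ^+ 5)%:P).
rewrite -(rmorph_nat phi) -polyC_natr -rmorphM -polyCM.
have -> : 27%:R * a ^+ 5 * 288%:R = (a * 6%:R) ^+ 5.
  rewrite exprMn -natrX mulrAC -natrM [RHS]mulrC.
  by congr (_ * _); congr (_%:R).
by rewrite a6 expr1n polyC1 rmorph1.
Qed.

(** * A graph with two values *)

(** Entry 0 is the empty graph, so the [i]-th step defines entry [i]. Entries 50
    and 54 are the same graph with 22 vertices, evaluated by the seven-term
    relation at two different paths. *)
Definition steps : seq step := [::
  Step Circle 0 [::]
    [:: (0, [::])];
  Step Bigon 0 [:: [:: 1]]
    [:: (1, [::])];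
  Step Bigon 2 [:: [:: 3]; [::]; [:: 1; 3; 3]]
    [:: (2, [:: 0; 1])];
  Step Square 2 [:: [:: 5]; [:: 5]; [::]; [::]; [:: 2; 3; 5]]
    [:: (3, [:: 0; 3; 2; 1]); (2, [:: 0; 1]); (2, [:: 0; 1])];
  Step Bigon 6 [:: [:: 5]; [::]; [:: 1; 6; 7]; [:: 5; 6; 7]; [:: 5; 6; 7]]
    [:: (4, [:: 2; 3; 4; 5; 0; 1])];
  Step Square 6 [:: [:: 7]; [:: 7]; [::]; [::]; [:: 2; 8; 9]; [:: 3; 8; 9];
    [:: 7; 8; 9]]
    [:: (5, [:: 0; 5; 3; 4; 2; 1; 6; 7]); (4, [:: 2; 3; 4; 5; 0; 1]);
    (4, [:: 2; 3; 4; 5; 0; 1])];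
  Step Square 4 [:: [:: 7]; [:: 6]; [::]; [::]; [:: 2; 6; 7]; [:: 3; 6; 7]]
    [:: (4, [:: 2; 0; 3; 4; 1; 5]); (3, [:: 0; 2; 3; 1]); (3, [:: 0; 2; 1;
    3])];
  Step Square 8 [:: [:: 9]; [:: 8]; [::]; [::]; [:: 2; 10; 11]; [:: 3; 10;
    11]; [:: 8; 9; 10]; [:: 8; 9; 11]]
    [:: (6, [:: 4; 0; 2; 3; 5; 6; 8; 9; 1; 7]); (7, [:: 2; 3; 4; 5; 6; 7; 0;
    1]); (7, [:: 2; 3; 4; 5; 7; 6; 0; 1])];
  Step Bigon 4 [:: [:: 4]; [::]; [:: 1; 4; 5]; [:: 4; 5; 5]]
    [:: (3, [:: 0; 2; 1; 3])];
  Step Square 6 [:: [:: 8]; [:: 7]; [::]; [::]; [:: 2; 7; 9]; [:: 3; 8; 9];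
    [:: 7; 8; 9]]
    [:: (7, [:: 2; 0; 3; 4; 5; 1; 7; 6]); (4, [:: 2; 4; 3; 0; 5; 1]);
    (9, [:: 0; 3; 2; 1; 5; 4])];
  Step Square 10 [:: [:: 10]; [:: 9]; [::]; [::]; [:: 2; 11; 12]; [:: 3; 11;
    13]; [:: 9; 10; 11]; [:: 9; 12; 13]; [:: 10; 12; 13]]
    [:: (8, [:: 2; 9; 6; 7; 3; 4; 5; 0; 1; 8; 10; 11]); (10, [:: 2; 4; 3; 6;
    5; 7; 1; 0; 8; 9]); (10, [:: 2; 4; 3; 5; 6; 1; 7; 0; 8; 9])];
  Step Square 8 [:: [:: 9]; [:: 8]; [::]; [::]; [:: 2; 8; 10]; [:: 3; 10; 11];
    [:: 8; 9; 11]; [:: 9; 10; 11]]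
    [:: (10, [:: 2; 0; 3; 4; 5; 6; 1; 8; 7; 9]); (7, [:: 2; 3; 4; 5; 0; 7; 1;
    6]); (5, [:: 0; 3; 2; 4; 1; 6; 5; 7])];
  Step Square 12 [:: [:: 11]; [:: 10]; [::]; [::]; [:: 2; 12; 13]; [:: 3; 12;
    14]; [:: 10; 12; 15]; [:: 10; 13; 14]; [:: 11; 13; 15]; [:: 11; 14; 15]]
    [:: (11, [:: 4; 0; 2; 3; 5; 6; 8; 7; 11; 12; 1; 10; 9; 13]); (12, [:: 2;
    7; 6; 5; 3; 4; 11; 0; 9; 1; 10; 8]); (12, [:: 3; 5; 2; 4; 6; 7; 0; 11; 1;
    8; 10; 9])];
  Step Seven 11 [:: [:: 10]; [:: 11]; [:: 12]; [:: 14]; [::]; [:: 10; 12; 13];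
    [:: 10; 14; 15]; [:: 4; 13; 15]; [:: 11; 12; 15]; [:: 11; 13; 14]]
    [:: (11, [:: 9; 3; 7; 2; 4; 6; 5; 8; 0; 13; 1; 10; 12; 11]); (11, [:: 9;
    3; 7; 5; 2; 6; 8; 4; 1; 12; 13; 11; 0; 10]); (12, [:: 3; 6; 5; 7; 4; 2;
    11; 0; 8; 9; 1; 10]); (12, [:: 3; 4; 2; 7; 6; 5; 0; 11; 8; 10; 1; 9]);
    (12, [:: 3; 5; 2; 7; 6; 4; 1; 8; 11; 10; 0; 9]); (12, [:: 3; 2; 5; 7; 4;
    6; 1; 8; 0; 9; 11; 10])];
  Step Square 14 [:: [:: 12]; [:: 11]; [::]; [::]; [:: 2; 13; 14]; [:: 3; 13;
    15]; [:: 11; 12; 16]; [:: 11; 14; 17]; [:: 12; 15; 17]; [:: 13; 16; 17];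
    [:: 14; 15; 16]]
    [:: (13, [:: 2; 11; 8; 9; 3; 4; 5; 6; 7; 0; 1; 15; 13; 14; 10; 12]);
    (14, [:: 1; 2; 6; 3; 7; 5; 4; 10; 9; 0; 8; 12; 13; 11]); (11, [:: 2; 8; 5;
    3; 7; 6; 4; 1; 13; 10; 0; 12; 11; 9])];
  Step Square 12 [:: [:: 11]; [:: 10]; [::]; [::]; [:: 2; 12; 13]; [:: 3; 14;
    15]; [:: 10; 12; 14]; [:: 10; 13; 15]; [:: 11; 12; 15]; [:: 11; 13; 14]]
    [:: (14, [:: 1; 0; 2; 5; 3; 4; 6; 7; 8; 9; 10; 12; 11; 13]); (12, [:: 3;
    7; 5; 6; 2; 4; 11; 0; 1; 8; 10; 9]); (12, [:: 3; 7; 2; 4; 5; 6; 0; 11; 1;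
    8; 9; 10])];
  Step Square 16 [:: [:: 13]; [:: 12]; [::]; [::]; [:: 2; 14; 15]; [:: 3; 14;
    16]; [:: 12; 14; 17]; [:: 12; 18; 19]; [:: 13; 15; 18]; [:: 13; 17; 19];
    [:: 15; 16; 19]; [:: 16; 17; 18]]
    [:: (15, [:: 4; 0; 3; 2; 5; 9; 7; 10; 6; 8; 13; 14; 1; 11; 12; 15; 17;
    16]); (13, [:: 2; 8; 9; 6; 3; 5; 4; 7; 15; 1; 11; 0; 13; 14; 10; 12]);
    (16, [:: 2; 4; 3; 5; 8; 6; 9; 7; 1; 12; 0; 11; 13; 10; 15; 14])];
  Step Square 10 [:: [:: 10]; [:: 9]; [::]; [::]; [:: 2; 11; 12]; [:: 3; 11;
    13]; [:: 9; 10; 12]; [:: 9; 11; 13]; [:: 10; 12; 13]]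
    [:: (12, [:: 2; 9; 6; 7; 3; 5; 4; 1; 0; 11; 8; 10]); (6, [:: 4; 2; 5; 3;
    6; 1; 9; 0; 8; 7]); (10, [:: 2; 4; 5; 3; 6; 1; 9; 0; 8; 7])];
  Step Square 12 [:: [:: 11]; [:: 10]; [::]; [::]; [:: 2; 12; 13]; [:: 3; 12;
    14]; [:: 10; 11; 13]; [:: 10; 12; 15]; [:: 11; 14; 15]; [:: 13; 14; 15]]
    [:: (18, [:: 2; 10; 6; 8; 3; 4; 5; 7; 0; 1; 12; 9; 13; 11]); (8, [:: 2; 6;
    3; 7; 5; 4; 8; 1; 9; 0; 10; 11]); (12, [:: 3; 5; 4; 2; 7; 6; 0; 10; 1; 8;
    11; 9])];
  Step Bigon 8 [:: [:: 6]; [::]; [:: 1; 7; 8]; [:: 6; 7; 9]; [:: 6; 8; 9];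
    [:: 7; 8; 9]]
    [:: (7, [:: 2; 4; 5; 3; 7; 0; 1; 6])];
  Step Square 10 [:: [:: 10]; [:: 9]; [::]; [::]; [:: 2; 9; 11]; [:: 9; 10;
    12]; [:: 3; 12; 13]; [:: 10; 11; 13]; [:: 11; 12; 13]]
    [:: (12, [:: 3; 1; 2; 4; 5; 6; 7; 0; 8; 9; 10; 11]); (10, [:: 2; 3; 4; 5;
    6; 0; 1; 8; 7; 9]); (20, [:: 0; 2; 5; 3; 4; 1; 7; 6; 8; 9])];
  Step Seven 13 [:: [:: 12]; [:: 15]; [:: 13]; [:: 17]; [::]; [:: 11; 12; 13];
    [:: 11; 14; 15]; [:: 4; 11; 16]; [:: 12; 14; 17]; [:: 13; 14; 16]; [:: 15;
    16; 17]]
    [:: (19, [:: 11; 2; 8; 3; 7; 6; 5; 4; 9; 10; 1; 0; 12; 15; 13; 14]);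
    (16, [:: 10; 3; 6; 5; 8; 7; 2; 9; 4; 15; 1; 14; 11; 12; 13; 0]);
    (11, [:: 2; 8; 5; 7; 4; 6; 3; 13; 12; 10; 11; 1; 9; 0]); (21, [:: 3; 4; 7;
    8; 2; 5; 6; 11; 0; 9; 10; 13; 12; 1]); (21, [:: 3; 6; 5; 8; 2; 7; 4; 12;
    1; 13; 10; 9; 11; 0]); (11, [:: 2; 3; 6; 7; 4; 5; 8; 9; 0; 1; 11; 10; 13;
    12])];
  Step Square 14 [:: [:: 12]; [:: 11]; [::]; [::]; [:: 2; 13; 14]; [:: 3; 15;
    16]; [:: 11; 13; 15]; [:: 11; 14; 17]; [:: 12; 14; 16]; [:: 12; 15; 17];
    [:: 13; 16; 17]]
    [:: (22, [:: 1; 0; 2; 5; 3; 6; 8; 4; 7; 10; 13; 11; 15; 9; 14; 12]);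
    (11, [:: 2; 7; 8; 4; 3; 5; 6; 12; 1; 10; 0; 13; 9; 11]); (21, [:: 3; 8; 4;
    2; 6; 7; 5; 0; 13; 9; 1; 11; 12; 10])];
  Step Bigon 10 [:: [:: 7]; [::]; [:: 1; 8; 9]; [:: 7; 8; 10]; [:: 7; 9; 11];
    [:: 8; 10; 11]; [:: 9; 10; 11]]
    [:: (10, [:: 2; 3; 5; 4; 6; 1; 0; 8; 7; 9])];
  Step Square 12 [:: [:: 12]; [:: 10]; [::]; [::]; [:: 2; 10; 11]; [:: 3; 11;
    13]; [:: 10; 13; 14]; [:: 11; 14; 15]; [:: 12; 13; 15]; [:: 12; 14; 15]]
    [:: (21, [:: 4; 0; 3; 2; 5; 6; 7; 8; 9; 1; 11; 10; 12; 13]); (12, [:: 2;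
    3; 4; 5; 6; 7; 0; 1; 9; 8; 10; 11]); (24, [:: 0; 3; 2; 4; 5; 6; 1; 7; 10;
    8; 9; 11])];
  Step Seven 15 [:: [:: 14]; [:: 17]; [:: 16]; [:: 19]; [::]; [:: 12; 13; 14];
    [:: 12; 15; 17]; [:: 13; 15; 16]; [:: 14; 15; 19]; [:: 12; 16; 18]; [:: 4;
    13; 18]; [:: 17; 18; 19]]
    [:: (15, [:: 11; 7; 3; 10; 5; 9; 4; 8; 6; 2; 15; 16; 14; 13; 17; 1; 12;
    0]); (23, [:: 11; 3; 7; 5; 8; 9; 2; 10; 6; 4; 16; 15; 1; 12; 17; 14; 13;
    0]); (19, [:: 3; 9; 4; 7; 5; 6; 8; 2; 13; 15; 14; 12; 10; 0; 11; 1]);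
    (13, [:: 8; 6; 5; 7; 9; 4; 3; 2; 12; 10; 15; 14; 13; 1; 0; 11]);
    (25, [:: 3; 6; 5; 7; 4; 8; 9; 2; 13; 14; 10; 11; 15; 1; 12; 0]);
    (16, [:: 6; 8; 7; 9; 4; 5; 2; 3; 15; 11; 12; 13; 14; 10; 1; 0])];
  Step Square 16 [:: [:: 13]; [:: 12]; [::]; [::]; [:: 2; 14; 17]; [:: 3; 15;
    16]; [:: 12; 14; 15]; [:: 12; 18; 19]; [:: 13; 14; 18]; [:: 13; 16; 19];
    [:: 15; 17; 19]; [:: 16; 17; 18]]
    [:: (26, [:: 1; 0; 2; 8; 9; 4; 6; 3; 7; 5; 15; 12; 17; 16; 11; 14; 13;
    10]); (13, [:: 8; 3; 2; 5; 9; 6; 4; 7; 1; 15; 11; 0; 10; 13; 14; 12]);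
    (19, [:: 3; 8; 2; 4; 5; 9; 6; 7; 0; 14; 1; 11; 15; 10; 12; 13])];
  Step Square 14 [:: [:: 12]; [:: 11]; [::]; [::]; [:: 2; 13; 14]; [:: 3; 13;
    15]; [:: 11; 14; 16]; [:: 11; 15; 17]; [:: 12; 14; 17]; [:: 12; 15; 16];
    [:: 13; 16; 17]]
    [:: (16, [:: 4; 0; 2; 3; 8; 6; 9; 7; 5; 12; 13; 1; 11; 10; 15; 14]);
    (11, [:: 2; 8; 4; 7; 3; 5; 6; 12; 1; 10; 0; 13; 11; 9]); (11, [:: 2; 8; 3;
    5; 4; 7; 6; 1; 12; 10; 0; 13; 9; 11])];
  Step Bigon 8 [:: [:: 6]; [::]; [:: 1; 6; 7]; [:: 6; 8; 9]; [:: 7; 8; 9];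
    [:: 7; 8; 9]]
    [:: (5, [:: 0; 2; 3; 4; 1; 5; 6; 7])];
  Step Square 10 [:: [:: 11]; [:: 9]; [::]; [::]; [:: 2; 9; 10]; [:: 9; 10;
    12]; [:: 3; 12; 13]; [:: 10; 11; 13]; [:: 11; 12; 13]]
    [:: (12, [:: 2; 1; 3; 4; 5; 6; 7; 0; 8; 9; 10; 11]); (10, [:: 2; 3; 4; 5;
    6; 0; 1; 8; 7; 9]); (29, [:: 0; 2; 4; 3; 5; 1; 6; 8; 7; 9])];
  Step Square 12 [:: [:: 11]; [:: 10]; [::]; [::]; [:: 2; 10; 12]; [:: 3; 12;
    13]; [:: 10; 11; 14]; [:: 11; 13; 15]; [:: 12; 14; 15]; [:: 13; 14; 15]]
    [:: (30, [:: 3; 9; 4; 5; 2; 6; 7; 8; 0; 1; 10; 12; 11; 13]); (12, [:: 3;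
    2; 4; 6; 5; 7; 0; 8; 1; 9; 10; 11]); (24, [:: 0; 3; 2; 5; 4; 6; 1; 8; 7;
    10; 9; 11])];
  Step Seven 15 [:: [:: 14]; [:: 18]; [:: 16]; [:: 19]; [::]; [:: 12; 13; 14];
    [:: 4; 12; 15]; [:: 12; 16; 17]; [:: 13; 15; 16]; [:: 14; 17; 19]; [:: 13;
    18; 19]; [:: 15; 17; 18]]
    [:: (28, [:: 11; 6; 3; 8; 7; 10; 9; 4; 2; 5; 17; 12; 14; 15; 16; 13; 1;
    0]); (28, [:: 11; 3; 6; 5; 7; 9; 10; 2; 4; 8; 15; 13; 1; 17; 16; 12; 14;
    0]); (19, [:: 3; 8; 9; 7; 6; 5; 2; 4; 15; 11; 14; 13; 10; 12; 0; 1]);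
    (19, [:: 3; 4; 9; 6; 7; 2; 5; 8; 13; 12; 0; 15; 10; 11; 14; 1]);
    (31, [:: 3; 5; 9; 7; 8; 2; 4; 6; 13; 12; 1; 14; 15; 11; 10; 0]);
    (22, [:: 1; 2; 7; 3; 6; 5; 8; 4; 11; 15; 0; 12; 10; 9; 13; 14])];
  Step Square 14 [:: [:: 12]; [:: 11]; [::]; [::]; [:: 2; 13; 14]; [:: 3; 13;
    15]; [:: 11; 14; 15]; [:: 11; 16; 17]; [:: 12; 14; 16]; [:: 12; 15; 17];
    [:: 13; 16; 17]]
    [:: (13, [:: 6; 15; 8; 9; 7; 3; 4; 5; 2; 10; 12; 11; 13; 14; 0; 1]);
    (18, [:: 3; 7; 5; 8; 2; 4; 6; 13; 0; 9; 1; 11; 10; 12]); (18, [:: 3; 6; 2;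
    5; 4; 8; 7; 1; 12; 9; 0; 10; 11; 13])];
  Step Seven 15 [:: [:: 14]; [:: 15]; [:: 16]; [:: 17]; [::]; [:: 4; 12; 13];
    [:: 12; 14; 18]; [:: 13; 15; 19]; [:: 12; 16; 19]; [:: 13; 17; 18];
    [:: 14; 17; 19]; [:: 15; 16; 18]]
    [:: (32, [:: 0; 1; 4; 2; 7; 6; 8; 5; 3; 9; 17; 14; 12; 13; 16; 10; 15;
    11]); (33, [:: 11; 3; 7; 6; 5; 8; 9; 4; 2; 10; 15; 14; 1; 16; 17; 0; 13;
    12]); (19, [:: 3; 9; 8; 4; 5; 6; 7; 2; 14; 13; 15; 0; 1; 10; 11; 12]);
    (19, [:: 3; 9; 4; 8; 6; 5; 2; 7; 13; 14; 0; 15; 10; 1; 12; 11]);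
    (19, [:: 3; 9; 5; 6; 8; 4; 2; 7; 14; 13; 1; 10; 15; 0; 12; 11]);
    (19, [:: 3; 9; 6; 5; 4; 8; 7; 2; 13; 14; 10; 1; 0; 15; 11; 12])];
  Step Square 16 [:: [:: 13]; [:: 12]; [::]; [::]; [:: 2; 14; 16]; [:: 3; 15;
    17]; [:: 12; 14; 18]; [:: 12; 15; 19]; [:: 13; 16; 19]; [:: 13; 17; 18];
    [:: 14; 17; 19]; [:: 15; 16; 18]]
    [:: (34, [:: 1; 0; 2; 3; 8; 4; 9; 5; 7; 6; 12; 13; 15; 10; 14; 11; 17;
    16]); (19, [:: 3; 9; 7; 8; 2; 4; 6; 5; 15; 0; 10; 14; 1; 13; 12; 11]);
    (19, [:: 3; 9; 2; 4; 7; 8; 5; 6; 0; 15; 1; 13; 10; 14; 11; 12])];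
  Step Bigon 12 [:: [:: 8]; [::]; [:: 1; 9; 10]; [:: 8; 9; 11]; [:: 8; 12;
    13]; [:: 9; 12; 13]; [:: 10; 11; 12]; [:: 10; 11; 13]]
    [:: (8, [:: 2; 3; 5; 4; 6; 7; 1; 0; 9; 8; 10; 11])];
  Step Square 14 [:: [:: 12]; [:: 11]; [::]; [::]; [:: 2; 11; 13]; [:: 11; 14;
    15]; [:: 3; 14; 16]; [:: 12; 13; 15]; [:: 12; 14; 17]; [:: 13; 16; 17];
    [:: 15; 16; 17]]
    [:: (19, [:: 3; 1; 2; 4; 5; 6; 7; 8; 9; 0; 10; 11; 12; 13; 14; 15]);
    (18, [:: 2; 6; 8; 3; 4; 5; 7; 10; 0; 1; 12; 9; 13; 11]); (36, [:: 0; 2; 6;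
    3; 7; 4; 5; 1; 11; 8; 10; 9; 12; 13])];
  Step Square 12 [:: [:: 11]; [:: 10]; [::]; [::]; [:: 2; 12; 13]; [:: 3; 12;
    14]; [:: 10; 11; 15]; [:: 10; 13; 14]; [:: 11; 13; 15]; [:: 12; 14; 15]]
    [:: (21, [:: 4; 11; 7; 8; 3; 5; 2; 6; 9; 0; 13; 10; 12; 1]); (12, [:: 2;
    7; 4; 5; 3; 6; 10; 0; 9; 1; 11; 8]); (8, [:: 2; 6; 5; 3; 4; 7; 1; 10; 9;
    0; 8; 11])];
  Step Square 14 [:: [:: 12]; [:: 11]; [::]; [::]; [:: 2; 13; 14]; [:: 3; 13;
    15]; [:: 11; 12; 16]; [:: 11; 13; 17]; [:: 12; 14; 17]; [:: 14; 15; 16];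
    [:: 15; 16; 17]]
    [:: (38, [:: 5; 1; 3; 2; 9; 4; 7; 6; 8; 12; 14; 0; 10; 11; 15; 13]);
    (18, [:: 2; 8; 4; 6; 3; 5; 7; 12; 0; 10; 1; 13; 11; 9]); (11, [:: 2; 4; 5;
    3; 6; 8; 7; 1; 11; 0; 10; 12; 13; 9])];
  Step Square 14 [:: [:: 12]; [:: 11]; [::]; [::]; [:: 2; 13; 16]; [:: 3; 14;
    15]; [:: 11; 12; 17]; [:: 11; 13; 14]; [:: 12; 13; 15]; [:: 14; 16; 17];
    [:: 15; 16; 17]]
    [:: (13, [:: 3; 10; 6; 7; 2; 4; 5; 8; 9; 0; 1; 12; 13; 14; 15; 11]);
    (18, [:: 2; 7; 4; 5; 3; 8; 6; 11; 0; 1; 13; 9; 10; 12]); (18, [:: 2; 7; 4;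
    3; 5; 6; 8; 0; 11; 1; 9; 13; 10; 12])];
  Step Seven 17 [:: [:: 13]; [:: 18]; [:: 14]; [:: 17]; [::]; [:: 13; 14; 15];
    [:: 13; 16; 17]; [:: 15; 16; 19]; [:: 14; 19; 20]; [:: 15; 18; 21];
    [:: 16; 18; 20]; [:: 4; 19; 21]; [:: 17; 20; 21]]
    [:: (27, [:: 13; 2; 9; 3; 5; 6; 4; 7; 10; 8; 11; 1; 0; 12; 15; 16; 19; 14;
    17; 18]); (35, [:: 12; 3; 6; 4; 2; 8; 10; 11; 9; 7; 5; 0; 14; 16; 13; 1;
    18; 19; 17; 15]); (32, [:: 1; 4; 3; 6; 2; 9; 8; 5; 7; 10; 0; 13; 11; 12;
    16; 14; 17; 15]); (37, [:: 3; 4; 2; 7; 5; 9; 8; 10; 6; 0; 11; 13; 12; 1;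
    17; 15; 14; 16]); (39, [:: 10; 5; 9; 4; 2; 7; 8; 3; 6; 15; 1; 13; 14; 16;
    17; 0; 12; 11]); (40, [:: 2; 3; 4; 7; 5; 6; 8; 9; 10; 0; 1; 11; 13; 16;
    12; 14; 15; 17])];
  Step Square 14 [:: [:: 12]; [:: 11]; [::]; [::]; [:: 2; 13; 14]; [:: 3; 13;
    15]; [:: 11; 12; 16]; [:: 11; 14; 15]; [:: 12; 14; 17]; [:: 13; 16; 17];
    [:: 15; 16; 17]]
    [:: (38, [:: 9; 15; 8; 6; 5; 7; 4; 2; 3; 14; 12; 11; 13; 10; 1; 0]);
    (18, [:: 3; 7; 4; 5; 2; 6; 8; 11; 0; 9; 1; 13; 12; 10]); (11, [:: 2; 6; 5;
    3; 4; 8; 7; 1; 11; 10; 0; 9; 13; 12])];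
  Step Square 14 [:: [:: 12]; [:: 11]; [::]; [::]; [:: 2; 13; 14]; [:: 3; 13;
    15]; [:: 11; 12; 14]; [:: 11; 15; 16]; [:: 12; 16; 17]; [:: 14; 15; 17];
    [:: 13; 16; 17]]
    [:: (38, [:: 2; 11; 6; 8; 3; 4; 5; 7; 9; 0; 1; 15; 10; 13; 12; 14]);
    (18, [:: 3; 6; 2; 8; 5; 4; 7; 10; 1; 9; 0; 12; 13; 11]); (11, [:: 2; 6; 3;
    5; 7; 4; 8; 1; 9; 10; 0; 11; 13; 12])];
  Step Seven 17 [:: [:: 13]; [:: 16]; [:: 20]; [:: 21]; [::]; [:: 13; 14; 15];
    [:: 13; 17; 18]; [:: 4; 14; 19]; [:: 15; 16; 19]; [:: 14; 17; 20]; [:: 15;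
    18; 20]; [:: 16; 17; 21]; [:: 18; 19; 21]]
    [:: (17, [:: 12; 7; 3; 11; 8; 6; 5; 9; 10; 2; 4; 18; 17; 16; 1; 13; 15;
    14; 19; 0]); (41, [:: 13; 3; 7; 6; 2; 5; 8; 9; 10; 1; 4; 12; 17; 18; 16;
    0; 15; 14; 19; 11]); (42, [:: 3; 10; 8; 9; 5; 6; 7; 2; 4; 17; 16; 15; 1;
    12; 14; 13; 11; 0]); (15, [:: 9; 6; 10; 3; 2; 7; 8; 4; 5; 16; 11; 12; 0;
    14; 15; 1; 17; 13]); (43, [:: 3; 7; 6; 10; 5; 8; 9; 2; 4; 11; 16; 15; 1;
    12; 14; 13; 17; 0]); (28, [:: 10; 6; 9; 3; 4; 7; 8; 5; 2; 16; 11; 14; 13;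
    15; 12; 0; 17; 1])];
  Step Square 18 [:: [:: 14]; [:: 13]; [::]; [::]; [:: 2; 15; 16]; [:: 3; 17;
    18]; [:: 13; 15; 19]; [:: 13; 20; 21]; [:: 14; 16; 20]; [:: 14; 17; 19];
    [:: 15; 18; 21]; [:: 16; 17; 21]; [:: 18; 19; 20]]
    [:: (44, [:: 2; 0; 5; 1; 7; 8; 10; 9; 3; 6; 4; 18; 19; 12; 17; 14; 11; 15;
    16; 13]); (28, [:: 2; 10; 9; 6; 3; 5; 8; 4; 7; 16; 1; 12; 0; 13; 17; 15;
    11; 14]); (43, [:: 10; 3; 8; 9; 4; 2; 7; 5; 6; 17; 0; 16; 13; 1; 11; 12;
    14; 15])];
  Step Square 18 [:: [:: 14]; [:: 13]; [::]; [::]; [:: 2; 15; 17]; [:: 3; 16;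
    18]; [:: 13; 16; 19]; [:: 13; 15; 20]; [:: 14; 17; 19]; [:: 14; 18; 21];
    [:: 15; 16; 21]; [:: 17; 18; 20]; [:: 19; 20; 21]]
    [:: (44, [:: 2; 19; 9; 10; 5; 1; 7; 8; 6; 4; 3; 0; 18; 14; 17; 15; 16; 12;
    11; 13]); (33, [:: 2; 10; 7; 8; 3; 5; 9; 4; 6; 16; 1; 12; 17; 0; 13; 11;
    14; 15]); (42, [:: 2; 9; 4; 3; 8; 10; 5; 6; 7; 0; 17; 1; 13; 12; 16; 14;
    11; 15])];
  Step Bigon 14 [:: [:: 9]; [::]; [:: 1; 10; 11]; [:: 9; 10; 12]; [:: 9; 13;
    14]; [:: 10; 13; 15]; [:: 11; 12; 13]; [:: 11; 14; 15]; [:: 12; 14; 15]]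
    [:: (11, [:: 2; 3; 5; 4; 6; 8; 7; 1; 0; 10; 9; 11; 13; 12])];
  Step Square 16 [:: [:: 14]; [:: 12]; [::]; [::]; [:: 2; 12; 13]; [:: 12; 15;
    16]; [:: 3; 15; 17]; [:: 13; 14; 18]; [:: 13; 16; 17]; [:: 14; 16; 19];
    [:: 15; 18; 19]; [:: 17; 18; 19]]
    [:: (42, [:: 2; 1; 3; 4; 5; 6; 7; 8; 9; 10; 0; 11; 12; 13; 14; 15; 16;
    17]); (38, [:: 9; 8; 6; 5; 7; 4; 2; 3; 15; 14; 12; 11; 13; 10; 1; 0]);
    (47, [:: 0; 2; 6; 4; 3; 5; 7; 8; 1; 9; 13; 11; 10; 12; 14; 15])];
  Step Square 16 [:: [:: 19]; [:: 18]; [::]; [::]; [:: 12; 13; 14]; [:: 12;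
    13; 15]; [:: 2; 12; 16]; [:: 3; 13; 17]; [:: 14; 15; 18]; [:: 14; 16; 19];
    [:: 15; 17; 19]; [:: 16; 17; 18]]
    [:: (15, [:: 9; 13; 3; 2; 4; 5; 6; 7; 8; 10; 0; 1; 11; 12; 14; 15; 16;
    17]); (38, [:: 6; 8; 2; 9; 7; 3; 4; 5; 11; 15; 10; 13; 1; 12; 14; 0]);
    (38, [:: 8; 6; 9; 2; 7; 4; 3; 5; 15; 11; 13; 10; 12; 1; 14; 0])];
  Step Seven 19 [:: [:: 14]; [:: 15]; [:: 16]; [:: 18]; [::]; [:: 14; 16; 17];
    [:: 14; 18; 20]; [:: 4; 19; 21]; [:: 15; 17; 22]; [:: 15; 19; 23]; [:: 17;
    19; 20]; [:: 16; 21; 23]; [:: 18; 21; 22]; [:: 20; 22; 23]]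
    [:: (45, [:: 14; 2; 8; 3; 4; 9; 7; 12; 6; 5; 11; 10; 0; 20; 1; 13; 16; 19;
    15; 17; 21; 18]); (46, [:: 13; 3; 7; 4; 2; 6; 11; 12; 8; 10; 5; 9; 0; 20;
    15; 17; 1; 19; 14; 16; 18; 21]); (41, [:: 5; 3; 4; 1; 6; 9; 2; 7; 8; 10;
    11; 17; 13; 12; 14; 0; 15; 16; 18; 19]); (48, [:: 3; 2; 4; 10; 9; 11; 7;
    6; 5; 8; 0; 19; 1; 14; 12; 18; 13; 15; 16; 17]); (49, [:: 3; 7; 2; 5; 11;
    8; 10; 4; 6; 9; 1; 18; 13; 17; 0; 15; 19; 12; 16; 14]); (49, [:: 4; 5; 7;
    2; 8; 9; 10; 6; 3; 11; 13; 14; 12; 15; 1; 19; 17; 0; 18; 16])];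
  Step Square 18 [:: [:: 14]; [:: 13]; [::]; [::]; [:: 2; 15; 17]; [:: 3; 16;
    18]; [:: 13; 15; 16]; [:: 13; 19; 20]; [:: 14; 17; 19]; [:: 14; 18; 21];
    [:: 16; 19; 21]; [:: 15; 20; 21]; [:: 17; 18; 20]]
    [:: (41, [:: 1; 11; 3; 4; 2; 9; 7; 8; 10; 6; 5; 0; 16; 12; 15; 13; 14; 19;
    17; 18]); (33, [:: 3; 10; 7; 8; 2; 5; 9; 6; 4; 16; 1; 11; 17; 0; 13; 12;
    14; 15]); (43, [:: 10; 2; 8; 9; 4; 3; 6; 7; 5; 17; 0; 16; 12; 13; 1; 14;
    15; 11])];
  Step Square 18 [:: [:: 14]; [:: 13]; [::]; [::]; [:: 2; 15; 16]; [:: 3; 17;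
    18]; [:: 13; 15; 19]; [:: 13; 20; 21]; [:: 14; 16; 21]; [:: 14; 17; 20];
    [:: 15; 18; 20]; [:: 16; 17; 19]; [:: 18; 19; 21]]
    [:: (41, [:: 1; 16; 7; 8; 9; 2; 3; 4; 10; 5; 6; 0; 11; 19; 13; 14; 18; 17;
    15; 12]); (28, [:: 2; 10; 8; 7; 3; 5; 9; 4; 6; 17; 1; 12; 0; 13; 16; 14;
    15; 11]); (42, [:: 2; 10; 3; 4; 8; 9; 5; 6; 7; 0; 17; 1; 12; 16; 15; 11;
    13; 14])];
  Step Square 16 [:: [:: 14]; [:: 12]; [::]; [::]; [:: 2; 12; 13]; [:: 12; 15;
    16]; [:: 3; 15; 17]; [:: 13; 14; 16]; [:: 13; 17; 18]; [:: 14; 18; 19];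
    [:: 15; 18; 19]; [:: 16; 17; 19]]
    [:: (43, [:: 2; 1; 3; 4; 5; 6; 7; 8; 10; 9; 0; 11; 12; 13; 14; 15; 16;
    17]); (38, [:: 2; 6; 8; 3; 4; 5; 9; 7; 11; 0; 1; 15; 10; 13; 12; 14]);
    (47, [:: 0; 2; 6; 3; 4; 8; 7; 5; 1; 9; 12; 11; 10; 13; 14; 15])];
  Step Seven 19 [:: [:: 16]; [:: 18]; [:: 19]; [:: 21]; [::]; [:: 4; 14; 15];
    [:: 14; 16; 17]; [:: 14; 18; 20]; [:: 15; 17; 22]; [:: 15; 19; 23];
    [:: 17; 19; 20]; [:: 16; 21; 23]; [:: 18; 21; 22]; [:: 20; 22; 23]]
    [:: (51, [:: 14; 9; 2; 8; 12; 4; 7; 10; 11; 5; 3; 6; 17; 19; 18; 20; 0;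
    21; 15; 1; 13; 16]); (52, [:: 14; 2; 8; 9; 5; 11; 10; 7; 12; 3; 4; 6; 17;
    20; 1; 18; 16; 21; 19; 0; 15; 13]); (49, [:: 2; 4; 5; 7; 8; 9; 10; 6; 3;
    11; 13; 14; 12; 15; 1; 19; 17; 0; 18; 16]); (49, [:: 4; 3; 6; 2; 11; 8; 9;
    5; 7; 10; 0; 18; 12; 16; 1; 14; 19; 13; 17; 15]); (53, [:: 3; 10; 6; 5; 8;
    9; 11; 2; 4; 7; 15; 18; 1; 17; 12; 19; 16; 0; 13; 14]); (44, [:: 1; 10; 6;
    5; 8; 4; 3; 9; 2; 7; 17; 16; 14; 13; 0; 11; 12; 19; 18; 15])]]%N.

Lemma two_evaluations : exists p, exists2 q,
  two_values steps 50 54 [:: 0; 3; 1; 4; 5; 2; 6; 7; 8; 9; 10; 11; 12; 13; 14; 15;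
                             16; 17; 18; 19; 20; 21]%N = Some (p, q) &
  zpoly_add p (zpoly_scale (-1) q) = zpoly_scale 288 pE_coefs.
Proof. by do 2!eexists; vm_compute; reflexivity. Qed.

(* A commutative Z[1/6, n]-algebra [k], given by its structure morphism. *)
Theorem theorem4p3 (k : comPzRingType) (phi : {rmorphism {poly Zinv6} -> k}) :
  generated_ideal (@E_relation k (phi 'X)) (phi pE *: lin_diag k empty_diag).
Proof.
have [p [q E pq]] := two_evaluations.
have Ipq := two_values_ideal (n := phi 'X) E.
have diff : zpoly_eval (phi 'X) p - zpoly_eval (phi 'X) q = 288%:R * phi pE.
  rewrite -pE_coefsE -[288%:R]/((int_of_Z 288)%:~R) -zpoly_evalZ -pq.
  by rewrite zpoly_evalD zpoly_evalZ -[_%:~R]/(-1) mulN1r.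
rewrite diff in Ipq; have [u u288] := natr288_unit phi.
have := tensor_idealZ (generated_ideal_tensor (phi 'X)) u Ipq.
by rewrite scalerA mulrA u288 mul1r.
Qed.
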